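(* Let $X$ be a separable real Hilbert space, and let $f:X\to\mathbb{R}$ be a Lipschitz function. Then for every $\varepsilon>0$ there exists a Lipschitz, real analytic function $g:X\to\mathbb{R}$ such that $|f(x)-g(x)|\leq\varepsilon$ for all $x\in X$, and $\mathrm{Lip}(g)\leq\mathrm{Lip}(f)+\varepsilon$.
   Context: $\mathrm{Lip}(f)$ denotes the Lipschitz constant of $f$ on $X$. A function $g:X\to\mathbb{R}$ is real analytic if for every $x\in X$ there are a neighbourhood $N_x$ of $x$ and continuous $n$-homogeneous polynomials $P_n^x:X\to\mathbb{R}$ (i.e. $P_n^x(h)=A(h,\dots,h)$ with $A$ continuous $n$-multilinear) such that $g(x+h)=\sum_{n\geq 0}P_n^x(h)$ whenever $x+h\in N_x$. *)

(* Defs.v *)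
From mathcomp Require Import all_boot all_order all_algebra.
From mathcomp Require Import sesquilinear.
From mathcomp Require Import all_classical all_reals all_analysis.
Import Order.TTheory GRing.Theory Num.Theory.
Import numFieldNormedType.Exports.

Set Implicit Arguments.
Unset Strict Implicit.
Unset Printing Implicit Defensive.

Local Open Scope classical_set_scope.
Local Open Scope ring_scope.

Definition separable_space (T : topologicalType) : Prop :=
  exists2 D : set T, countable D & dense D.

(* The least Lipschitz constant of f; junk value 0 if f is not Lipschitz.
   The condition [0 <= k] only matters when V is the zero space, where every
   real k satisfies [k.-lipschitz f]. *)
Definition Lip (R : realType) (V W : normedModType R) (f : V -> W) : R :=
  inf [set k : R | 0 <= k /\ k.-lipschitz f].

Definition multilinear (R : realType) (X : normedModType R) (n : nat)
    (A : ('I_n -> X) -> R) : Prop :=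
  forall (i : 'I_n) (v : 'I_n -> X), scalar (fun u : X => A (dfwith v i u)).

(* X^n carries the product topology. *)
Definition homogeneous_polynomial (R : realType) (X : normedModType R)
    (n : nat) (P : X -> R) : Prop :=
  exists A : prod_topology (fun _ : 'I_n => X) -> R,
    [/\ multilinear A, continuous A & forall h : X, P h = A (fun _ => h)].

Definition real_analytic (R : realType) (X : normedModType R)
    (g : X -> R) : Prop :=
  forall x : X, exists (N : set X) (P : nat -> X -> R),
    [/\ nbhs x N,
        forall n, homogeneous_polynomial n (P n) &
        forall h : X, N (x + h) ->
          series (fun n => P n h) @ \oo --> g (x + h)].

(* Main.v *)
Require Import Defs.
From mathcomp Require Import all_boot all_order all_algebra.
From mathcomp Require Import sesquilinear.
From mathcomp Require Import all_classical all_reals all_analysis.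
From mathcomp Require Import measurable_realfun ring lra.
Import Order.TTheory GRing.Theory Num.Theory.
Import numFieldNormedType.Exports.

(** Fix an orthonormal system [e_n] obtained from a dense sequence; write [x_n] for
    the coordinates of [x].  The approximant is
       g(x) = lim_N  E f (sum_(n < N) (a_n(x) + sg_n * xi_n) *: e_n)
    with independent standard Gaussian variables [xi_n] and [sg_n = s * 2^-n].

    Averaging over translations of the argument keeps every Lipschitz constant
    and moves a Lipschitz function by at most a multiple of [sum_n sg_n]. It
    also makes [f] analytic, but only along directions whose coordinates decay
    faster than the [sg_n]. This is why the coordinates [x_n] are replaced by
    coefficients [a_n(x)] that decay like [4^-n].

    The coefficients come from a map [T x = sum_n a_n(x) *: e_n] that is close
    to the identity. They are [a_n(x) = (1 - damping (level_n x)) * x_n],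
    where [level_n] is an analytic substitute for the positive part of [om^2 *
    |tail_n x|^2 - 1]. The tails [x - sum_(i < n) x_i *: e_i] tend to zero, so
    at a given point this positive part vanishes for all large [n], and the
    substitute is then of size [4^-n]; moreover its power series has a norm of
    that size on a ball that does not depend on [n]
    ([analytic_le_trunc_coef]). A cutoff of this kind costs a factor in the
    Lipschitz constant. The factor is brought down to [1 + zeta] by letting
    the damping vary slowly on the logarithmic scale of the tail, over a range
    [1 .. 2^m] with [m] large: the squares of the errors add up to the
    integral of [s * (1 / (m s))^2] over that range, which is of order [1 / m]
    ([truncation_lipschitz]). The displacement [|x - T x|] is bounded by [2 *
    2^m / om] ([truncation_displacement]), and [om] is free.

    Analyticity is handled by a calculus of power series with norms. The
    series of a function at a point is stored as one function on lists of
    vectors whose restriction to lists of length [n] is an [n]-linear form;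
    products are concatenation products, and the norm [analytic_le r M] is
    submultiplicative and complete. Square roots and inverses are solutions of
    quadratic equations, found by iteration ([analytic_le_quadratic]). The
    Gaussian means are expanded with the identity E phi(b + xi) = exp(-b^2/2)
    * E (phi(xi) * exp(b * xi)), where the exponential is a power series in
    [b] ([analytic_le_smoothing_step]). The increments in [N] of the smoothed
    functions have summable norms ([analytic_le_smoothing_increment]), hence
    the limit [g] is analytic. *)

Set Implicit Arguments.
Unset Strict Implicit.
Unset Printing Implicit Defensive.

Local Open Scope classical_set_scope.
Local Open Scope ring_scope.

(** * Power series on a normed space, with norms *)

Lemma cvgn_unique {R : realType} (f : nat -> R) (a b : R) :
  f @ \oo --> a -> f @ \oo --> b -> a = b.
Proof. by move=> ca cb; rewrite -(cvg_lim _ ca) // -(cvg_lim _ cb). Qed.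

Section Expansions.
Context {R : realType} {X : normedModType R}.
Implicit Types (A B : seq X -> R) (u v : X -> R) (h : X) (l : seq X).

(** The factor [1 / (n + 1)^2] makes the weights submultiplicative under
    convolution, see [weight_conv]; the constant [1 / 8] is what that takes. *)
Definition weight (n : nat) : R := (8 * n.+1%:R ^+ 2)^-1.

Definition gauge (r : R) l : R := \prod_(x <- l) (`|x| / r).

(** Linearity in every entry of the list: the restriction of [A] to lists of
    length [n] is an [n]-linear form. *)
Definition mlinear A := forall l1 l2, scalar (fun x : X => A (l1 ++ x :: l2)).

(** The polynomial of degree [n] is [h |-> A (nseq n h)]. The bound on [A] is
    a weighted supremum norm at radius [r]; it is pointwise in the list, so
    that it passes to pointwise limits. The sum is only required on half the
    radius, where the terms decay geometrically. *)
Definition expands (r M : R) A u := [/\ mlinear A,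
  forall l, `|A l| <= M * (weight (size l) * gauge r l) &
  forall h, `|h| <= r / 2 -> series (fun n => A (nseq n h)) @ \oo --> u h].

Definition analytic_le (r M : R) u := exists A, expands r M A u.

Lemma weight_gt0 n : 0 < weight n.
Proof. by rewrite invr_gt0 mulr_gt0 ?exprn_gt0. Qed.

Lemma weight_le n : weight n <= 8^-1.
Proof.
rewrite lef_pV2 ?posrE ?mulr_gt0 ?exprn_gt0 //.
by rewrite ler_peMr // exprn_ege1 // ler1n.
Qed.

Lemma sum_inv_sqr n : \sum_(i < n.+1) (i.+1%:R ^+ 2)^-1 <=
    2 - (n.+1%:R)^-1 :> R.
Proof.
elim: n => [|n IHn]; first by rewrite big_ord1 expr1n invr1; lra.
rewrite big_ord_recr /=; apply: le_trans (lerD IHn (lexx _)) _.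
have h0 : 0 < n.+1%:R :> R by rewrite ltr0n.
have -> : n.+2%:R = n.+1%:R + 1 :> R by rewrite -natr1.
move: h0; set a := n.+1%:R => a0.
rewrite -subr_ge0.
have -> : 2 - (a + 1)^-1 - (2 - a^-1 + ((a + 1) ^+ 2)^-1) =
  (a * (a + 1) ^+ 2)^-1 by field; apply/andP; split; lra.
by rewrite invr_ge0 mulr_ge0 ?exprn_ge0 //= ltW ?addr_gt0.
Qed.

(** With [a + b = n + 2], [((a + b) / (a b))^2 = (1/a + 1/b)^2] is at most [2
    (1/a^2 + 1/b^2)], and the inverse squares sum to at most [2]. *)
Lemma weight_conv n : \sum_(i < n.+1) weight i * weight (n - i) <= weight n.
Proof.
pose s (i : nat) : R := (i.+1%:R ^+ 2)^-1.
have term (i : 'I_n.+1) : weight i * weight (n - i) <=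
   (32 * n.+2%:R ^+ 2)^-1 * (s i + s (n - i)%N).
  have ein : (i <= n)%N by rewrite -ltnS.
  have -> : n.+2%:R = i.+1%:R + (n - i).+1%:R :> R.
    by rewrite -natrD addSn addnS subnKC.
  rewrite /weight /s; move: (ltr0Sn R i) (ltr0Sn R (n - i)).
  set a := i.+1%:R; set b := (n - i).+1%:R => a0 b0.
  rewrite -subr_ge0.
  have -> : (32 * (a + b) ^+ 2)^-1 * ((a ^+ 2)^-1 + (b ^+ 2)^-1) -
    (8 * a ^+ 2)^-1 * (8 * b ^+ 2)^-1 =
    (a - b) ^+ 2 / (64 * (a + b) ^+ 2 * a ^+ 2 * b ^+ 2).
    by field; rewrite ?gt_eqF //; lra.
  by rewrite divr_ge0 ?sqr_ge0 // !mulr_ge0 ?addr_ge0 // ltW.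
apply: le_trans (ler_sum _ (fun i _ => term i)) _.
rewrite -mulr_sumr big_split /= [X in _ + X](reindex_inj rev_ord_inj) /=.
have -> : \sum_(i < n.+1) s (n - (n.+1 - i.+1))%N = \sum_(i < n.+1) s i.
  by apply: eq_bigr => i _; rewrite subSS subKn // -ltnS.
have sle : \sum_(i < n.+1) s i <= 2.
  apply: le_trans (sum_inv_sqr n) _; rewrite lerBlDr lerDl invr_ge0.
  exact: ler0n.
apply: (@le_trans _ _ ((32 * n.+2%:R ^+ 2)^-1 * 4)).
  by rewrite ler_wpM2l ?invr_ge0 ?mulr_ge0 ?exprn_ge0 //; lra.
rewrite /weight; have -> : n.+2%:R = n.+1%:R + 1 :> R by rewrite -natr1.
move: (ltr0Sn R n); set a := n.+1%:R => a0.
have -> : (32 * (a + 1) ^+ 2)^-1 * 4 = (8 * (a + 1) ^+ 2)^-1.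
  by field; rewrite ?gt_eqF //; lra.
by rewrite lef_pV2 ?posrE ?mulr_gt0 ?exprn_gt0 //; nra.
Qed.

Lemma gauge_ge0 r l : 0 < r -> 0 <= gauge r l.
Proof. by move=> r0; apply: prodr_ge0 => i _; rewrite divr_ge0 // ltW. Qed.

Lemma gauge_cat r l1 l2 : gauge r (l1 ++ l2) = gauge r l1 * gauge r l2.
Proof. by rewrite /gauge big_cat. Qed.

Lemma gauge_nseq r n h : gauge r (nseq n h) = (`|h| / r) ^+ n.
Proof. by rewrite /gauge big_nseq iter_mulr_1. Qed.

Lemma weight_gauge_ge0 r l : 0 < r -> 0 <= weight (size l) * gauge r l.
Proof. by move=> r0; rewrite mulr_ge0 ?gauge_ge0 // ltW ?weight_gt0. Qed.

Lemma expands_ge0 r M A u : expands r M A u -> 0 <= M.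
Proof.
case=> _ /(_ [::]) + _; rewrite /gauge big_nil mulr1 => A0.
have := le_trans (normr_ge0 _) A0.
by rewrite pmulr_lge0 // weight_gt0.
Qed.

Lemma analytic_le_ge0 r M u : analytic_le r M u -> 0 <= M.
Proof. by case=> A /expands_ge0. Qed.

Lemma bound_nseq r M A n h : 0 < r -> 0 <= M ->
  (forall l, `|A l| <= M * (weight (size l) * gauge r l)) ->
  `|h| <= r / 2 -> `|A (nseq n h)| <= M * (weight n * 2^-1 ^+ n).
Proof.
move=> r0 M0 Ab hr; apply: le_trans (Ab _) _; rewrite size_nseq gauge_nseq.
rewrite ler_wpM2l //; apply: ler_wpM2l; first exact/ltW/weight_gt0.
by rewrite lerXn2r ?nnegrE ?divr_ge0 ?(ltW r0) // ler_pdivrMr // mulrC.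
Qed.

Lemma geo_half_tail N n :
  \sum_(N <= i < n) (8^-1 * 2^-1 ^+ i) <= 2^-1 ^+ N :> R.
Proof.
have [nN|Nn] := leqP n N; first by rewrite big_geq // exprn_ge0.
suff -> : \sum_(N <= i < n) (8^-1 * 2^-1 ^+ i) =
   4^-1 * (2^-1 ^+ N - 2^-1 ^+ n) :> R.
  have a0 : 0 <= 2^-1 ^+ N :> R by rewrite exprn_ge0.
  have b0 : 0 <= 2^-1 ^+ n :> R by rewrite exprn_ge0.
  by lra.
elim: n Nn => // n IHn; rewrite ltnS leq_eqVlt => /predU1P[<-|Nn].
  by rewrite big_nat1 exprS; lra.
rewrite big_nat_recr /=; last exact: ltnW.
by rewrite (IHn Nn) exprS; lra.
Qed.

(** Explicit rate of convergence, with a constant that depends on the norm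
    only; this makes evaluation continuous for the norm and gives the
    convergence of products and of limits of series. *)
Lemma expands_tail r M A u h N : 0 < r -> expands r M A u -> `|h| <= r / 2 ->
  `|u h - \sum_(n < N) A (nseq n h)| <= M * 2^-1 ^+ N.
Proof.
move=> r0 EA hr; have M0 := expands_ge0 EA; case: EA => _ Ab /(_ _ hr) cA.
have cB : `|series (fun n => A (nseq n h)) n - \sum_(n < N) A (nseq n h)|
    @[n --> \oo] --> `|u h - \sum_(n < N) A (nseq n h)|.
  by apply: cvg_norm; apply: cvgB => //; exact: cvg_cst.
rewrite -(cvg_lim _ cB) //; apply: limr_le; first by apply/cvg_ex;
  exists `|u h - \sum_(n < N) A (nseq n h)|.
near=> n; rewrite /series /= -(big_mkord xpredT (fun n => A (nseq n h))).
rewrite (@big_cat_nat _ _ _ N 0 n) //=; last by near: n; exact: nbhs_infty_ge.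
rewrite addrAC subrr add0r.
apply: le_trans (ler_norm_sum _ _ _) _.
apply: (@le_trans _ _ (\sum_(N <= i < n) M * (8^-1 * 2^-1 ^+ i))).
  apply: ler_sum => i _; apply: le_trans (bound_nseq _ r0 M0 Ab hr) _.
  by rewrite ler_wpM2l // ler_wpM2r ?exprn_ge0 ?weight_le.
by rewrite -mulr_sumr ler_wpM2l // geo_half_tail.
Unshelve. all: by end_near. Qed.

Lemma analytic_le_norm r M u h : 0 < r -> analytic_le r M u -> `|h| <= r / 2 ->
    `|u h| <= M.
Proof.
move=> r0 [A EA] hr; have := expands_tail 0 r0 EA hr.
by rewrite big_ord0 subr0 mulr1.
Qed.

Lemma cvg_half : (2^-1 : R) ^+ n @[n --> \oo] --> (0 : R).
Proof. by apply: cvg_expr; rewrite ger0_norm //; lra. Qed.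

(** The converse of [expands_tail], with a constant that may depend on [h]. *)
Lemma expands_intro r M A u : mlinear A ->
  (forall l, `|A l| <= M * (weight (size l) * gauge r l)) ->
  (forall h, `|h| <= r / 2 -> exists C : R, forall N,
     `|u h - \sum_(n < N) A (nseq n h)| <= C * 2^-1 ^+ N) ->
  expands r M A u.
Proof.
move=> mA Ab tA; split=> // h hr; have [C hC] := tA _ hr.
have c0 : C * (2^-1 : R) ^+ n @[n --> \oo] --> (0 : R).
  by rewrite -[X in _ --> X](mulr0 C); apply: cvgM cvg_half; exact: cvg_cst.
apply/cvgrPdist_le => e e0.
have /cvgrPdist_le/(_ _ e0) := c0.
apply: filterS => n; rewrite sub0r normrN => He.
rewrite /series /= big_mkord; apply: le_trans (hC n) _.
exact: le_trans (ler_norm _) He.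
Qed.

Lemma mlinearD A B : mlinear A -> mlinear B -> mlinear (fun l => A l + B l).
Proof. by move=> mA mB l1 l2 a x y; rewrite mA mB; ring. Qed.

Lemma mlinearZ c A : mlinear A -> mlinear (fun l => c * A l).
Proof. by move=> mA l1 l2 a x y; rewrite mA; ring. Qed.

Lemma expandsD r M N A B u v : expands r M A u -> expands r N B v ->
  expands r (M + N) (fun l => A l + B l) (fun h => u h + v h).
Proof.
move=> [mA bA cA] [mB bB cB]; split.
- exact: mlinearD.
- by move=> l; rewrite mulrDl; apply: le_trans (ler_normD _ _) _; exact: lerD.
- move=> h hr; apply: cvg_trans (cvgD (cA h hr) (cB h hr)).
  apply: near_eq_cvg; apply: nearW => n /=.
  by rewrite /series /= big_split.
Qed.

Lemma expandsZ r M A u c : expands r M A u ->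
  expands r (`|c| * M) (fun l => c * A l) (fun h => c * u h).
Proof.
move=> [mA bA cA]; split.
- exact: mlinearZ.
- by move=> l; rewrite normrM -mulrA; apply: ler_wpM2l.
- move=> h hr; apply: cvg_trans (cvgM (cvg_cst c) (cA h hr)).
  apply: near_eq_cvg; apply: nearW => n /=.
  by rewrite /series /= mulr_sumr.
Qed.

Lemma analytic_le_ext r M u v : 0 < r -> (forall h, `|h| <= r / 2 ->
    u h = v h) ->
  analytic_le r M u -> analytic_le r M v.
Proof.
by move=> r0 uv [A [mA bA cA]]; exists A; split=> // h hr; rewrite -uv //;
  exact: cA.
Qed.

Lemma analytic_le_weaken r M N u : 0 < r -> M <= N -> analytic_le r M u ->
    analytic_le r N u.
Proof.
move=> r0 MN [A [mA bA cA]]; exists A; split=> // l.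
apply: le_trans (bA l) _; rewrite ler_wpM2r // mulr_ge0 ?gauge_ge0 //.
exact/ltW/weight_gt0.
Qed.

Lemma analytic_leD r M N u v : analytic_le r M u -> analytic_le r N v ->
  analytic_le r (M + N) (fun h => u h + v h).
Proof. by move=> [A EA] [B EB]; eexists; exact: expandsD EA EB. Qed.

Lemma analytic_leZ r M u c : analytic_le r M u ->
    analytic_le r (`|c| * M) (fun h => c * u h).
Proof. by move=> [A EA]; eexists; exact: expandsZ EA. Qed.

Lemma analytic_le_cst r c : 0 < r -> analytic_le r (8 * `|c|) (fun=> c).
Proof.
move=> r0; exists (fun l => if l is [::] then c else 0); apply: expands_intro.
- by move=> [|? ?] l2 a x y //=; ring.
- case=> [|x l]; last by rewrite normr0 mulr_ge0 ?weight_gauge_ge0 // mulr_ge0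
  // ?mulr_ge0 // ltW.
  by rewrite /gauge big_nil /weight expr1n /=; lra.
- move=> h hr; exists `|c| => -[|N]; first by rewrite big_ord0 subr0 mulr1.
  by rewrite big_ord_recl /= big1 ?addr0 ?subrr ?normr0 // mulr_ge0 //
    exprn_ge0.
Qed.

Lemma analytic_le0 r : 0 < r -> analytic_le r 0 (fun=> 0).
Proof. by move=> r0; have := analytic_le_cst 0 r0; rewrite normr0 mulr0. Qed.

Lemma sum_weight n : \sum_(i < n) weight i <= 1.
Proof.
case: n => [|n]; first by rewrite big_ord0.
have -> : \sum_(i < n.+1) weight i =
    8^-1 * \sum_(i < n.+1) (i.+1%:R ^+ 2)^-1 :> R.
  by rewrite mulr_sumr; apply: eq_bigr => i _; rewrite /weight invfM.
have n0 : 0 <= (n.+1%:R)^-1 :> R by rewrite invr_ge0.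
apply: (@le_trans _ _ (8^-1 * 2)); last by lra.
rewrite ler_wpM2l //; apply: le_trans (sum_inv_sqr n) _.
by rewrite lerBlDr lerDl.
Qed.

(** The Cauchy product of two series of multilinear forms, with the tensor
    product of forms in each degree: the first [i] entries go to [A] and the
    others to [B]. *)
Definition concat_mul A B l : R :=
  \sum_(0 <= i < (size l).+1) A (take i l) * B (drop i l).

Lemma mlinear_concat_mul A B : mlinear A -> mlinear B ->
    mlinear (concat_mul A B).
Proof.
move=> mA mB l1 l2 a x y; rewrite /concat_mul !size_cat /=.
rewrite mulr_sumr -big_split /=; apply: eq_bigr => i _.
rewrite !take_cat !drop_cat; case: ifP => _; first by rewrite mB; ring.
case: (i - size l1)%N => [|k] /=; last by rewrite mA; ring.
by rewrite cats0 (mB [::] l2); ring.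
Qed.

Lemma concat_mul_bound r M N A B : 0 < r -> 0 <= M -> 0 <= N ->
  (forall l, `|A l| <= M * (weight (size l) * gauge r l)) ->
  (forall l, `|B l| <= N * (weight (size l) * gauge r l)) ->
  forall l, `|concat_mul A B l| <= (M * N) * (weight (size l) * gauge r l).
Proof.
move=> r0 M0 N0 bA bB l; rewrite /concat_mul big_mkord.
apply: le_trans (ler_norm_sum _ _ _) _.
apply: (@le_trans _ _ (\sum_(i < (size l).+1)
    (M * N * gauge r l) * (weight i * weight (size l - i)))).
  apply: ler_sum => i _; rewrite normrM.
  apply: le_trans (ler_pM (normr_ge0 _) (normr_ge0 _) (bA _) (bB _)) _.
  rewrite size_drop size_takel; last by rewrite -ltnS.
  rewrite le_eqVlt; apply/orP; left; apply/eqP.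
  have -> : gauge r l = gauge r (take i l) * gauge r (drop i l).
    by rewrite -gauge_cat cat_take_drop.
  ring.
rewrite -mulr_sumr -!mulrA; do 2 rewrite ler_wpM2l //.
by rewrite [leRHS]mulrC ler_wpM2l ?gauge_ge0 // weight_conv.
Qed.

(** The partial sums of a Cauchy product, summed by rows. *)
Lemma triangle_sum (a b : nat -> R) N :
  \sum_(n < N) \sum_(i < n.+1) a i * b (n - i)%N =
  \sum_(i < N) a i * \sum_(j < N - i) b j.
Proof.
elim: N => [|N IHN]; first by rewrite !big_ord0.
rewrite big_ord_recr /= IHN [RHS]big_ord_recr /= subSnn big_ord1.
rewrite big_ord_recr /= subnn addrA -big_split /=; congr (_ + _).
apply: eq_bigr => i _; rewrite subSn; last exact: ltnW.
by rewrite [in RHS]big_ord_recr /= mulrDr.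
Qed.

Lemma analytic_leM r M N u v : 0 < r -> analytic_le r M u ->
    analytic_le r N v ->
  analytic_le r (M * N) (fun h => u h * v h).
Proof.
move=> r0 [A EA] [B EB]; exists (concat_mul A B).
have M0 := expands_ge0 EA; have N0 := expands_ge0 EB.
have [mA bA _] := EA; have [mB bB _] := EB.
apply: expands_intro; [exact: mlinear_concat_mul|exact: concat_mul_bound|].
move=> h hr; exists (2 * (M * N)) => K.
pose a i := A (nseq i h); pose b i := B (nseq i h).
have -> : \sum_(n < K) concat_mul A B (nseq n h) =
    \sum_(i < K) a i * \sum_(j < K - i) b j.
  rewrite -triangle_sum; apply: eq_bigr => n _.
  rewrite /concat_mul size_nseq big_mkord; apply: eq_bigr => i _.
  have ik : (i <= n)%N by rewrite -ltnS.
  rewrite drop_nseq; congr (A _ * _); apply: (@eq_from_nth _ h).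
    by rewrite size_takel ?size_nseq.
  move=> j; rewrite size_takel ?size_nseq // => ji.
  by rewrite nth_take // !nth_nseq ji; case: ifP.
have -> : u h * v h - \sum_(i < K) a i * \sum_(j < K - i) b j =
    \sum_(i < K) a i * (v h - \sum_(j < K - i) b j) +
    (u h - \sum_(i < K) a i) * v h.
  under [X in _ = X + _]eq_bigr do rewrite mulrBr.
  by rewrite sumrB -mulr_suml; ring.
apply: le_trans (ler_normD _ _) _.
have -> : 2 * (M * N) * 2^-1 ^+ K = M * N * 2^-1 ^+ K + M * 2^-1 ^+ K * N.
  by ring.
apply: lerD; last first.
  by rewrite normrM ler_pM // ?(expands_tail _ r0 EA) ?(analytic_le_norm r0 _
    hr) //; exists B.
apply: le_trans (ler_norm_sum _ _ _) _.
apply: (@le_trans _ _ (\sum_(i < K) (M * N * 2^-1 ^+ K) * weight i)).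
  apply: ler_sum => i _; rewrite normrM.
  apply: le_trans (ler_pM (normr_ge0 _) (normr_ge0 _)
    (bound_nseq _ r0 M0 bA hr) (expands_tail _ r0 EB hr)) _.
  rewrite le_eqVlt; apply/orP; left; apply/eqP.
  have -> : 2^-1 ^+ K = 2^-1 ^+ i * 2^-1 ^+ (K - i) :> R.
    by rewrite -exprD subnKC // ltnW.
  ring.
rewrite -mulr_sumr -[leRHS]mulr1 ler_wpM2l ?sum_weight //.
by rewrite !mulr_ge0 // exprn_ge0.
Qed.

Lemma mlinear_lim (A_ : nat -> seq X -> R) A : (forall k, mlinear (A_ k)) ->
  (forall l, A_ k l @[k --> \oo] --> A l) -> mlinear A.
Proof.
move=> mA cA l1 l2 a x y.
apply: cvgn_unique (cA _) _.
have -> : (fun k => A_ k (l1 ++ (a *: x + y) :: l2)) =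
   (fun k => a * A_ k (l1 ++ x :: l2) + A_ k (l1 ++ y :: l2)).
  by apply/funext => k; exact: mA.
by apply: cvgD => //; apply: cvgM => //; exact: cvg_cst.
Qed.

(** The norm is complete: multilinearity, the bound and the remainder estimate
    of [expands_tail] all pass to pointwise limits. *)
Lemma expands_lim r M (A_ : nat -> seq X -> R) (u_ : nat -> X -> R) A u :
  0 < r -> (forall k, expands r M (A_ k) (u_ k)) ->
  (forall l, A_ k l @[k --> \oo] --> A l) ->
  (forall h, `|h| <= r / 2 -> u_ k h @[k --> \oo] --> u h) ->
  expands r M A u.
Proof.
move=> r0 EA cA cu; apply: expands_intro.
- by apply: mlinear_lim cA => k; case: (EA k).
- move=> l; have cn : `|A_ k l| @[k --> \oo] --> `|A l|.
    by apply: cvg_norm; exact: cA.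
  rewrite -(cvg_lim _ cn) //.
  by apply: limr_le; [exact: cvgP cn|apply: nearW => k; case: (EA k)].
- move=> h hr; exists M => N.
  have cn : `|u_ k h - \sum_(n < N) A_ k (nseq n h)| @[k --> \oo] -->
      `|u h - \sum_(n < N) A (nseq n h)|.
    apply: cvg_norm; apply: cvgB; first exact: cu.
    by apply: cvg_big => [|n _]; [exact: add_continuous|exact: cA].
  rewrite -(cvg_lim _ cn) //; apply: limr_le; first exact: cvgP cn.
  by apply: nearW => k; exact: expands_tail (EA k) hr.
Qed.

Lemma analytic_le_series r M (m : nat -> R) (u_ : nat -> X -> R) u : 0 < r ->
  (forall k, analytic_le r (m k) (u_ k)) -> (forall n, \sum_(k < n) m k <= M) ->
  (forall h, `|h| <= r / 2 -> \sum_(k < n) u_ k h @[n --> \oo] --> u h) ->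
  analytic_le r M u.
Proof.
move=> r0 /choice[A_ EA] mM cu.
have m0 k : 0 <= m k by exact: expands_ge0 (EA k).
have EsA n : expands r M (fun l => \sum_(k < n) A_ k l)
                         (fun h => \sum_(k < n) u_ k h).
  have E : expands r (\sum_(k < n) m k) (fun l => \sum_(k < n) A_ k l)
                         (fun h => \sum_(k < n) u_ k h).
    elim: n => [|n IHn].
      have -> : (fun l => \sum_(k < 0) A_ k l) = (fun l => 0 * A_ 0%N l).
        by apply/funext => l; rewrite big_ord0 mul0r.
      have -> : (fun h => \sum_(k < 0) u_ k h) = (fun h => 0 * u_ 0%N h).
        by apply/funext => l; rewrite big_ord0 mul0r.
      by have := expandsZ 0 (EA 0%N); rewrite normr0 mul0r big_ord0.
    have -> : (fun l => \sum_(k < n.+1) A_ k l) =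
        (fun l => \sum_(k < n) A_ k l + A_ n l).
      by apply/funext => l; rewrite big_ord_recr.
    have -> : (fun h => \sum_(k < n.+1) u_ k h) =
        (fun h => \sum_(k < n) u_ k h + u_ n h).
      by apply/funext => l; rewrite big_ord_recr.
    by rewrite big_ord_recr; exact: expandsD.
  case: E => mE bE exp_moment; split=> // l; apply: le_trans (bE l) _.
  by rewrite ler_wpM2r ?weight_gauge_ge0.
have csA l : cvgn (series (fun k => A_ k l)).
  apply: normed_cvg.
  apply: (@series_le_cvg _ _ (fun k => m k * (weight (size l) * gauge r l))).
  - by move=> k; exact: normr_ge0.
  - by move=> k; rewrite mulr_ge0 ?weight_gauge_ge0.
  - by move=> k /=; case: (EA k) => _ bA _; exact: bA.
  - apply: nondecreasing_is_cvgn.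
      apply: nondecreasing_series => k _ _.
      by rewrite mulr_ge0 ?weight_gauge_ge0.
    exists (M * (weight (size l) * gauge r l)) => _ [n _ <-].
    by rewrite /series /= big_mkord -mulr_suml ler_wpM2r ?weight_gauge_ge0.
exists (fun l => limn (series (fun k => A_ k l))).
apply: (expands_lim r0 EsA _ cu) => l.
have -> : (fun n => \sum_(k < n) A_ k l) = series (fun k => A_ k l).
  by apply/funext => n; rewrite /series /= big_mkord.
exact: csA.
Qed.

(** A series without constant term gains a factor [c] in each of its terms
    when the radius is multiplied by [c]. *)
Lemma analytic_le_shrink r M u c : 0 < r -> 0 < c <= 1 -> u 0 = 0 ->
    analytic_le r M u ->
  analytic_le (c * r) (c * M) u.
Proof.
move=> r0 /andP[c0 c1] u0 [A EA]; have M0 := expands_ge0 EA; exists A.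
have AE : A [::] = 0.
  have hr : `|0 : X| <= r / 2 by rewrite normr0 divr_ge0 // ltW.
  case: (EA) => mA _ /(_ _ hr) cA.
  rewrite -u0; apply/esym; apply: cvgn_unique cA _.
  rewrite -cvg_shiftS /=; apply: cvg_near_cst; apply: nearW => n /=.
  rewrite /series /= big_mkord big_ord_recl /= big1 ?addr0 // => i _.
  have := mA [::] (nseq i 0) 0 0 0.
  by rewrite scale0r addr0 mul0r add0r /= =>
    E; have := mA [::] (nseq i 0) 1 0 0; rewrite scale1r addr0 mul1r /= =>
      E2; lra.
case: EA => mA bA cA; split=> //.
- case=> [|x l].
    rewrite AE normr0 mulr_ge0 ?(weight_gauge_ge0 [::] (mulr_gt0 c0 r0)) //.
    by rewrite mulr_ge0 // ltW.
  apply: le_trans (bA _) _; rewrite /gauge !big_cons -/(gauge r l) -/(gauge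
    (c * r) l).
  have g_le : gauge r l <= gauge (c * r) l.
    apply: ler_prod => y _; rewrite divr_ge0 ?(ltW r0) //=.
    by rewrite ler_wpM2l // lef_pV2 ?posrE ?mulr_gt0 // ler_piMl // ltW.
  have -> : c * M * (weight (size (x :: l)) * (`|x| / (c * r) * gauge
    (c * r) l))
    = M * (weight (size (x :: l)) * (`|x| / r * gauge (c * r) l)).
    by field; apply/andP; split; lra.
  rewrite ler_wpM2l // ler_wpM2l //; first exact/ltW/weight_gt0.
  by rewrite ler_wpM2l // divr_ge0 // ltW.
- move=> h hr; apply: cA; apply: le_trans hr _.
  by rewrite ler_wpM2r // ler_piMl // ltW.
Qed.

(** The constant is the inverse of [weight 1]. *)
Lemma analytic_le_linear r (phi : X -> R) C : 0 < r -> 0 <= C -> scalar phi ->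
  (forall x, `|phi x| <= C * `|x|) -> analytic_le r (32 * C * r) phi.
Proof.
move=> r0 C0 lphi bphi.
exists (fun l => if l is [:: x] then phi x else 0); apply: expands_intro.
- move=> [|y [|? ?]] [|? ?] a x z //=; try ring; exact: lphi.
- move=> [|x [|y l]].
  + rewrite normr0 /gauge big_nil.
    by rewrite mulr1 !mulr_ge0 // ltW ?weight_gt0.
  + rewrite /gauge big_cons big_nil /weight /=; apply: le_trans (bphi x) _.
    rewrite le_eqVlt; apply/orP; left; apply/eqP; field; lra.
  + by rewrite normr0 mulr_ge0 ?weight_gauge_ge0 // mulr_ge0 // ?mulr_ge0 //
    ltW.
- move=> h hr; exists (2 * `|phi h|) => -[|[|N]].
  + by rewrite big_ord0 subr0 mulr1 ler_peMl // ler1n.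
  + by rewrite big_ord1 /= subr0 expr1; lra.
  + by rewrite !big_ord_recl /= big1 ?addr0 ?add0r ?subrr ?normr0 // !mulr_ge0
    // exprn_ge0.

Qed.

End Expansions.

(** * Quadratic equations among analytic functions *)

Section QuadraticEquation.
Context {R : realType} {X : normedModType R}.
Implicit Types (A B : seq X -> R) (u v : X -> R) (h : X) (l : seq X).

(** The constant is the inverse of [weight 2]. *)
Lemma analytic_le_bilinear r (b : X -> X -> R) C : 0 < r -> 0 <= C ->
  (forall y, scalar (b^~ y)) -> (forall x, scalar (b x)) ->
  (forall x y, `|b x y| <= C * (`|x| * `|y|)) ->
  analytic_le r (72 * C * r ^+ 2) (fun h => b h h).
Proof.
move=> r0 C0 lb rb bb.
exists (fun l => if l is [:: x; y] then b x y else 0); apply: expands_intro.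
- by move=> [|y [|z [|? ?]]] [|s [|? ?]] a x t //=; try ring;
  [exact: lb|exact: rb].
- move=> [|x [|y [|z l]]].
  + by rewrite normr0 mulr_ge0 ?weight_gauge_ge0 // !mulr_ge0 // ltW.
  + by rewrite normr0 mulr_ge0 ?weight_gauge_ge0 // !mulr_ge0 // ltW.
  + rewrite /gauge !big_cons big_nil /weight /=; apply: le_trans (bb x y) _.
    rewrite le_eqVlt; apply/orP; left; apply/eqP; field; lra.
  + by rewrite normr0 mulr_ge0 ?weight_gauge_ge0 // !mulr_ge0 // ltW.
- move=> h hr; exists (4 * `|b h h|) => -[|[|[|N]]].
  + by rewrite big_ord0 subr0 mulr1 ler_peMl // ler1n.
  + by rewrite big_ord1 /= subr0 expr1; have := normr_ge0 (b h h); lra.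
  + rewrite !big_ord_recl /= big_ord0 !addr0 subr0.
    by have := normr_ge0 (b h h); lra.
  + by rewrite !big_ord_recl /= big1 ?addr0 ?add0r ?subrr ?normr0 // !mulr_ge0
    // exprn_ge0.
Qed.

(** The iteration [y |-> a + b y + c y^2] from [0] contracts in norm by [1/2],
    so its increments form a summable series of analytic functions; pointwise
    it contracts towards the given solution [z], because the other root is
    excluded by the bound on [c z]. *)
Lemma analytic_le_quadratic r al a b c z : 0 < r -> analytic_le r al a ->
    analytic_le r 4^-1 b ->
  `|c| * al <= 16^-1 ->
  (forall h, `|h| <= r / 2 -> z h = a h + b h * z h + c * z h ^+ 2) ->
  (forall h, `|h| <= r / 2 -> `|c * z h| <= 2^-1) ->
  analytic_le r (2 * al) z.
Proof.
move=> r0 Aa Ab cal zE zc; have al0 := analytic_le_ge0 Aa.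
pose y := fix y k h : R := if k is k'.+1
  then a h + b h * y k' h + c * y k' h ^+ 2 else 0.
(* [y k] is the sum of the first [k] increments. *)
pose inc k h := y k.+1 h - y k h.
have ysum k h : y k h = \sum_(j < k) inc j h.
  elim: k => [|k IHk]; first by rewrite big_ord0.
  by rewrite big_ord_recr /= -IHk /inc subrKC.
have Hinc k : [/\ analytic_le r (al * 2^-1 ^+ k) (inc k) &
                 analytic_le r (2 * al * (1 - 2^-1 ^+ k)) (y k)].
  elim: k => [|k [IHi IHy]].
    split; last by rewrite expr0 subrr mulr0; exact: analytic_le0.
    rewrite expr0 mulr1; apply: analytic_le_ext Aa => // h _.
    by rewrite /inc /= expr0n mulr0 mulr0 !addr0 subr0.
  have IHy1 : analytic_le r (2 * al * (1 - 2^-1 ^+ k.+1)) (y k.+1).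
    have -> : 2 * al * (1 - 2^-1 ^+ k.+1) =
        al * 2^-1 ^+ k + 2 * al * (1 - 2^-1 ^+ k) by rewrite exprS; lra.
    by apply: analytic_le_ext (analytic_leD IHi IHy) =>
      // h _; rewrite /inc subrK.
  split=> //.
  have yle j : analytic_le r (2 * al * (1 - 2^-1 ^+ j)) (y j) ->
    analytic_le r (2 * al) (y j).
    apply: analytic_le_weaken => //;
      rewrite ler_piMr ?mulr_ge0 // gerBl exprn_ge0 //; lra.
  have := analytic_leM r0 (analytic_leD Ab (analytic_leZ c (analytic_leD
    (yle _ IHy1) (yle _ IHy)))) IHi.
  move=> H; apply: analytic_le_ext (analytic_le_weaken r0 _ H) => // [h _|].
    by rewrite /inc /=; ring.
  have -> : al * 2^-1 ^+ k.+1 = 2^-1 * (al * 2^-1 ^+ k) by rewrite exprS; ring.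
  rewrite ler_wpM2r //; first by rewrite mulr_ge0 // exprn_ge0.
  by lra.
have yb k h : `|h| <= r / 2 -> `|y k h| <= 2 * al.
  move=> hr; have [_ H] := Hinc k.
  apply: le_trans (analytic_le_norm r0 H hr) _.
  by rewrite ler_piMr ?mulr_ge0 // gerBl exprn_ge0 //; lra.
apply: (analytic_le_series r0 (fun k => (Hinc k).1)).
  move=> n; rewrite -mulr_sumr mulrC ler_wpM2r //.
  have -> : \sum_(i < n) 2^-1 ^+ i = 2 * (1 - 2^-1 ^+ n) :> R.
    elim: n => [|n IHn]; first by rewrite big_ord0 subrr mulr0.
    by rewrite big_ord_recr /= IHn exprS; lra.
  by rewrite ler_piMr // gerBl exprn_ge0.
move=> h hr.
have -> : (fun n => \sum_(k < n) inc k h) = y^~ h by apply/funext => n.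
have Hz k : `|z h - y k h| <= `|z h| * (7 / 8) ^+ k.
  elim: k => [|k IHk]; first by rewrite /= subr0 mulr1.
  have -> : z h - y k.+1 h = (b h + c * z h + c * y k h) * (z h - y k h).
    by rewrite {1}(zE h hr) /=; ring.
  rewrite normrM exprS mulrCA ler_pM //.
  have H1 := analytic_le_norm r0 Ab hr; have H2 := zc h hr.
  have H3 : `|c * y k h| <= 8^-1.
    rewrite normrM; apply: le_trans (ler_wpM2l (normr_ge0 _) (yb k h hr)) _.
    lra.
  have := ler_normD (b h + c * z h) (c * y k h).
  have := ler_normD (b h) (c * z h). lra.
have c0 : `|z h| * (7 / 8 : R) ^+ n @[n --> \oo] --> (0 : R).
  rewrite -[X in _ --> X](mulr0 `|z h|); apply: cvgM; first exact: cvg_cst.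
  by apply: cvg_expr; rewrite ger0_norm //; lra.
apply/cvgrPdist_le => e e0; have /cvgrPdist_le/(_ _ e0) := c0.
apply: filterS => n; rewrite sub0r normrN => He.
apply: le_trans (Hz n) _; exact: le_trans (ler_norm _) He.
Qed.

End QuadraticEquation.

(** * From power series with norms to real analyticity *)

Section RealAnalytic.
Context {R : realType} {X : normedModType R}.
Implicit Types (A B : seq X -> R) (u v : X -> R) (h : X) (l : seq X).

(** Change the entries of the list one at a time; [p] holds the entries that
    are already changed. *)
Lemma mlinear_lipschitz (I : eqType) r M A (v v' : I -> X) (k d : R) :
  0 < r -> 0 <= M -> mlinear A ->
  (forall l, `|A l| <= M * (weight (size l) * gauge r l)) ->
  1 <= k -> 0 <= d -> (forall i, `|v i| / r <= k) ->
    (forall i, `|v' i| / r <= k) ->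
  (forall i, `|v i - v' i| / r <= d) -> forall (s : seq I) (p : seq X),
  `|A (p ++ map v s) - A (p ++ map v' s)| <=
    M * gauge r p * (k ^+ size s * (size s)%:R * d).
Proof.
move=> r0 M0 mA bA k1 d0 vk v'k vd.
have gk (s : seq I) : gauge r (map v s) <= k ^+ size s.
  elim: s => [|i s IHs]; first by rewrite /gauge big_nil.
  by rewrite /gauge big_cons /= exprS ler_pM ?gauge_ge0 // divr_ge0 // ltW.
have k0 : 0 <= k by lra.
elim=> [|i s IHs] p.
  by rewrite subrr normr0 /= mulr0 mul0r mulr0.
have -> : A (p ++ map v (i :: s)) - A (p ++ map v' (i :: s)) =
   A (p ++ (v i - v' i) :: map v s) +
   (A ((p ++ [:: v' i]) ++ map v s) - A ((p ++ [:: v' i]) ++ map v' s)).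
  rewrite -!catA /=; have := mA p (map v s) (-1) (v' i) (v i).
  by rewrite scaleN1r [- v' i + _]addrC => ->; ring.
apply: le_trans (ler_normD _ _) _.
have H1 : `|A (p ++ (v i - v' i) :: map v s)| <=
    M * gauge r p * (k ^+ (size s).+1 * d).
  apply: le_trans (bA _) _.
  rewrite gauge_cat {2}/gauge big_cons -/(gauge r _) -[leRHS]mulrA ler_wpM2l //.
  apply: (@le_trans _ _ (1 * (gauge r p *
    (`|v i - v' i| / r * gauge r [seq v i | i <- s])))).
    rewrite ler_wpM2r ?mulr_ge0 ?gauge_ge0 ?invr_ge0 ?(ltW r0) //.
    by apply: le_trans (weight_le _) _; lra.
  rewrite mul1r ler_wpM2l ?gauge_ge0 // mulrC ler_pM ?gauge_ge0 //.
    by rewrite divr_ge0 // ltW.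
  by apply: le_trans (gk s) _; rewrite exprS ler_peMl // exprn_ge0.
apply: le_trans (lerD H1 (IHs _)) _.
rewrite gauge_cat /gauge big_seq1 -/(gauge r p).
have -> : M * (gauge r p * (`|v' i| / r)) * (k ^+ size s * (size s)%:R * d) =
   M * gauge r p * ((`|v' i| / r) * (k ^+ size s * (size s)%:R * d)) by ring.
rewrite -mulrDr ler_wpM2l ?mulr_ge0 ?gauge_ge0 //=.
have -> : k ^+ (size s).+1 * (size s).+1%:R * d =
  k ^+ (size s).+1 * d + k * (k ^+ size s * (size s)%:R * d).
  by rewrite -natr1 exprS; ring.
by rewrite lerD2l ler_wpM2r // ?mulr_ge0 // ?exprn_ge0.
Qed.

Lemma mlinear_close n r M A (v : 'I_n -> X) (e : R) : 0 < r -> 0 <= M ->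
    mlinear A ->
  (forall l, `|A l| <= M * (weight (size l) * gauge r l)) -> 0 < e ->
  exists2 d, 0 < d & forall w : 'I_n -> X, (forall i, `|v i - w i| < d) ->
    `|A [seq v i | i <- enum 'I_n] - A [seq w i | i <- enum 'I_n]| <= e.
Proof.
move=> r0 M0 mA bA e0.
have sum0 (P : pred 'I_n) : 0 <= \sum_(i < n | P i) (`|v i| + 1) / r.
  by apply: sumr_ge0 => i _; rewrite divr_ge0 ?addr_ge0 // ltW.
(* A common bound for [v] and for the points at distance at most [1] from it. *)
pose k : R := 1 + \sum_(i < n) (`|v i| + 1) / r.
have k1 : 1 <= k by rewrite /k lerDl.
have vk i : (`|v i| + 1) / r <= k.
  by rewrite /k (bigD1 i) //= addrCA lerDl addr_ge0.
pose C := M * (k ^+ n * n%:R) + 1.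
have C0 : 0 < C.
  by rewrite ltr_wpDl // mulr_ge0 // mulr_ge0 // exprn_ge0 // (le_trans _ k1).
pose d := Num.min 1 (r * (e / C)).
have d0 : 0 < d by rewrite lt_min ltr01 mulr_gt0 // divr_gt0.
exists d => // w Hw.
have Hd i : `|v i - w i| / r <= e / C.
  rewrite ler_pdivrMr // mulrC; apply: le_trans (ltW (Hw i)) _.
  by rewrite ge_min lexx orbT.
have := @mlinear_lipschitz 'I_n r M A v w k (e / C) r0 M0 mA bA k1
  (ltW (divr_gt0 e0 C0)) _ _ Hd (enum 'I_n) [::].
rewrite !cat0s size_enum_ord /gauge big_nil mulr1 => H.
apply: le_trans (H _ _) _.
- move=> i; apply: le_trans (vk i).
  by rewrite ler_wpM2r ?invr_ge0 ?(ltW r0) // lerDl.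
- move=> i; apply: le_trans (vk i).
  rewrite ler_wpM2r ?invr_ge0 ?(ltW r0) //.
  have -> : w i = v i - (v i - w i) by rewrite opprB addrC subrK.
  apply: le_trans (ler_normB _ _) _; rewrite lerD2l.
  by apply: le_trans (ltW (Hw i)) _; rewrite ge_min lexx.
- rewrite !mulrA ler_pdivrMr // mulrC -!mulrA ler_wpM2l ?(ltW e0) //.
  by rewrite /C lerDl.
Qed.

Lemma mlinear_continuous n r M A : 0 < r -> 0 <= M -> mlinear A ->
  (forall l, `|A l| <= M * (weight (size l) * gauge r l)) ->
  continuous ((fun v : 'I_n -> X => A [seq v i | i <- enum 'I_n])
    : prod_topology (fun _ : 'I_n => X) -> R).
Proof.
move=> r0 M0 mA bA v.
rewrite /continuous_at.
apply/(@cvgrPdist_le R R {ptws 'I_n -> X} (nbhs v)) => e e0.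
pose v0 : 'I_n -> X := v.
have [d d0 Hd] := mlinear_close v0 r0 M0 mA bA e0.
pose P (i : 'I_n) : set {ptws 'I_n -> X} := [set w | ball (v0 i) d (w i)].
have near_i i : nbhs (v : {ptws 'I_n -> X}) (P i).
  exact: (@proj_continuous _ (fun _ : 'I_n =>
    X) i v _ (nbhsx_ballx (v0 i) d d0)).
have near_all := @filter_forall _ _ P (nbhs (v : {ptws 'I_n -> X})) _ near_i.
apply: (@filterS _ (nbhs (v : {ptws 'I_n -> X})) _ _ _ _ (near_all _)) => w Hw.
apply: Hd => i; have := Hw i; rewrite /P /= -ball_normE; exact.
Qed.

Lemma mlinear_multilinear n A : mlinear A ->
  multilinear (fun v : 'I_n -> X => A [seq v i | i <- enum 'I_n]).
Proof.
move=> mA i v.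
have En : enum 'I_n = take i (enum 'I_n) ++ i :: drop i.+1 (enum 'I_n).
  rewrite -{1}(cat_take_drop i (enum 'I_n)); congr (_ ++ _).
  rewrite (drop_nth i) ?size_enum_ord //; congr (_ :: _).
  exact: nth_ord_enum.
have := enum_uniq 'I_n; rewrite {1}En cat_uniq /= => /and3P[_].
rewrite negb_or => /andP[it _] /andP[id _].
have E (u : X) : [seq dfwith v i u j | j <- enum 'I_n] =
    map v (take i (enum 'I_n)) ++ u :: map v (drop i.+1 (enum 'I_n)).
  rewrite {1}En map_cat /= dfwithin; congr (_ ++ _ :: _).
    apply/eq_in_map => j jt; rewrite dfwithout //.
    by apply: contraNneq it => ij; rewrite {1}ij.
  apply/eq_in_map => j jd; rewrite dfwithout //.
  by apply: contraNneq id => ij; rewrite {1}ij.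
by move=> a x y; rewrite !E; exact: mA.
Qed.

(** The [n]-linear forms of the definition are the restrictions of [A] to the
    lists of values of families indexed by ['I_n]. *)
Lemma analytic_le_real_analytic (g : X -> R) :
  (forall x, exists r M, 0 < r /\ analytic_le r M (fun h => g (x + h))) ->
  real_analytic g.
Proof.
move=> H x; have [r [M [r0 [A EA]]]] := H x.
have M0 := expands_ge0 EA; case: EA => mA bA cA.
exists [set y | `|x - y| <= r / 2], (fun n h => A (nseq n h)); split.
- apply/nbhs_ballP; exists (r / 2); first by rewrite /= divr_gt0.
  by move=> y; rewrite -ball_normE /= => /ltW.
- move=> n; exists (fun v : 'I_n -> X => A [seq v i | i <- enum 'I_n]); split.
  + exact: mlinear_multilinear.
  + exact: mlinear_continuous bA.
  + move=> h; rewrite -[in LHS](size_enum_ord n); congr (A _).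
    by elim: (enum 'I_n) => //= i s ->.
- move=> h /=; rewrite opprD addNKr normrN; exact: cA.
Qed.

End RealAnalytic.

(** * Gaussian means of functions on the line *)

Section Gauss.
Context {R : realType}.
Implicit Types (phi psi : R -> R) (b c t x : R).
Local Notation mu := (@lebesgue_measure R).

Let p t : R := normal_pdf 0 1 t.

Let oneN0 : (1 : R) != 0. Proof. exact: oner_neq0. Qed.

Let pE t : p t = normal_peak 1 * expR (- t ^+ 2 / 2).
Proof.
by rewrite /p normal_pdfE // /normal_fun subr0 expr1n.
Qed.

Let p_ge0 t : 0 <= p t. Proof. exact: normal_pdf_ge0. Qed.

Let p_continuous : continuous p. Proof. exact: continuous_normal_pdf. Qed.

Let p_shift b t : p (t - b) = expR (- b ^+ 2 / 2) * (expR (b * t) * p t).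
Proof.
have E : expR (- (t - b) ^+ 2 / 2) =
    expR (- b ^+ 2 / 2) * (expR (b * t) * expR (- t ^+ 2 / 2)).
  by rewrite -!expRD; congr expR; field.
by rewrite !pE E; ring.
Qed.

(** A class of functions that is stable under the operations used below and on
    which every Gaussian mean is finite. *)
Definition tame phi := continuous phi /\
  exists B k, forall t, `|phi t| <= B * expR (k * `|t|).

Definition gauss_mean phi : R := \int[mu]_t (phi t * p t).

Lemma tame_continuous phi : tame phi -> continuous phi. Proof. by case. Qed.

Lemma expR_abs_le k t : expR (k * `|t|) <= expR (k * t) + expR (- k * t).
Proof.
have [t0|t0] := ger0P t; first by rewrite lerDl expR_ge0.
by rewrite mulrN -mulNr lerDr expR_ge0.
Qed.

Let integrable_exp k : mu.-integrable setT (fun t => (expR (k * t) * p t)%:E).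
Proof.
have := @integrableZl _ _ _ mu setT measurableT (expR (k ^+ 2 / 2)) _
   (integrable_normal_pdf k 1).
apply: eq_integrable => // t _; rewrite -EFinM; congr EFin.
have -> : normal_pdf k 1 t = p (t - k).
  by rewrite /p !normal_pdfE // normal_fun_center.
have e : expR (k ^+ 2 / 2) * expR (- k ^+ 2 / 2) = 1.
  by rewrite -expRD mulNr subrr expR0.
by rewrite p_shift [LHS]mulrA e mul1r.
Qed.

Lemma tame_integrable phi : tame phi ->
  mu.-integrable setT (EFin \o (fun t => phi t * p t)).
Proof.
move=> [cphi [B [k Bk]]].
have B0 : 0 <= B.
  by have := le_trans (normr_ge0 _) (Bk 0); rewrite pmulr_lge0 // expR_gt0.
have i1 := integrable_exp k; have i2 := integrable_exp (- k).
have i3 := integrableZl measurableT B (integrableD measurableT i1 i2).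
apply: le_integrable i3 => //.
  apply/measurable_EFinP; apply: measurable_funM; last first.
    exact: measurable_normal_pdf.
  exact: continuous_measurable_fun.
move=> t _ /=; rewrite lee_fin normrM (ger0_norm (p_ge0 t)).
rewrite [leRHS]ger0_norm; last first.
  by rewrite mulr_ge0 // addr_ge0 // mulr_ge0 ?expR_ge0.
rewrite -mulrDl mulrA ler_wpM2r //.
by apply: le_trans (Bk t) _; rewrite ler_wpM2l ?expR_abs_le.
Qed.

Lemma gauss_meanD phi psi : tame phi -> tame psi ->
  gauss_mean (fun t => phi t + psi t) = gauss_mean phi + gauss_mean psi.
Proof.
move=> tphi tpsi; rewrite /gauss_mean -RintegralD ?tame_integrable //.
by apply: eq_Rintegral => t _ /=; rewrite mulrDl.
Qed.

Lemma gauss_meanZ c phi : tame phi ->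
    gauss_mean (fun t => c * phi t) = c * gauss_mean phi.
Proof.
move=> tphi; rewrite /gauss_mean -RintegralZl ?tame_integrable //.
by apply: eq_Rintegral => t _ /=; rewrite mulrA.
Qed.

Lemma gauss_mean_cst c : gauss_mean (fun=> c) = c.
Proof.
rewrite /gauss_mean RintegralZl //; last exact: integrable_normal_pdf.
by rewrite /Rintegral integral_normal_pdf mulr1.
Qed.

Lemma gauss_mean_le phi psi : tame phi -> tame psi ->
    (forall t, phi t <= psi t) ->
  gauss_mean phi <= gauss_mean psi.
Proof.
move=> tphi tpsi H; apply: le_Rintegral; rewrite ?tame_integrable //.
by move=> t _; rewrite ler_wpM2r.
Qed.

Lemma tame_norm_bound phi : tame phi -> exists B k, [/\ 0 <= B, 0 <= k &
  forall t, `|phi t| <= B * expR (k * `|t|)].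
Proof.
move=> [_ [B [k Bk]]]; exists B, `|k|; split=> //.
  by have := le_trans (normr_ge0 _) (Bk 0); rewrite pmulr_lge0 // expR_gt0.
move=> t; apply: le_trans (Bk t) _; rewrite ler_wpM2l //.
  by have := le_trans (normr_ge0 _) (Bk 0); rewrite pmulr_lge0 // expR_gt0.
by rewrite ler_expR ler_wpM2r // ler_norm.
Qed.

Lemma tameD phi psi : tame phi -> tame psi -> tame (fun t => phi t + psi t).
Proof.
move=> tphi tpsi; split.
  by move=> t; apply: cvgD; apply: tame_continuous.
have [B [k [B0 k0 Bk]]] := tame_norm_bound tphi.
have [C [l [C0 l0 Cl]]] := tame_norm_bound tpsi.
exists (B + C), (k + l) => t; apply: le_trans (ler_normD _ _) _.
rewrite mulrDl lerD //.
  apply: le_trans (Bk t) _; rewrite ler_wpM2l // ler_expR ler_wpM2r //.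
  by rewrite lerDl.
apply: le_trans (Cl t) _; rewrite ler_wpM2l // ler_expR ler_wpM2r //.
by rewrite lerDr.
Qed.

Lemma tameM phi psi : tame phi -> tame psi -> tame (fun t => phi t * psi t).
Proof.
move=> [cphi [B [k Bk]]] [cpsi [C [l Cl]]]; split.
  by move=> t; apply: cvgM; [exact: cphi|exact: cpsi].
exists (B * C), (k + l) => t; rewrite normrM mulrDl expRD mulrACA.
exact: ler_pM.
Qed.

Lemma tame_cst c : tame (fun=> c).
Proof.
split; first by move=> t; exact: cvg_cst.
by exists `|c|, 0 => t; rewrite mul0r expR0 mulr1.
Qed.

Lemma tame_exp k : tame (fun t => expR (k * t)).
Proof.
split.
  move=> t; apply: (@continuous_comp _ _ _ (fun t => k * t) expR).
    by apply: cvgM; [exact: cvg_cst|exact: cvg_id].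
  exact: continuous_expR.
exists 1, `|k| => t; rewrite mul1r ger0_norm ?expR_ge0 // ler_expR -normrM.
exact: ler_norm.
Qed.

Lemma tame_exp_abs k : tame (fun t => expR (k * `|t|)).
Proof.
split.
  move=> t; apply: (@continuous_comp _ _ _ (fun t => k * `|t|) expR).
    by apply: cvgM; [exact: cvg_cst|exact: norm_continuous].
  exact: continuous_expR.
by exists 1, k => t; rewrite mul1r ger0_norm ?expR_ge0.
Qed.

Lemma tame_lipschitz phi L : (forall s t, `|phi s - phi t| <= L * `|s - t|) ->
  tame phi.
Proof.
move=> Lphi; split.
  move=> t; apply/cvgrPdist_le => e e0.
  have L1 : 0 < `|L| + 1 by rewrite ltr_wpDl.
  have /cvgrPdist_le/(_ (e / (`|L| + 1))) : x @[x --> t] --> t by exact: cvg_id.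
  move=> /(_ (divr_gt0 e0 L1)); apply: filterS => s.
  rewrite ler_pdivlMr // => H; apply: le_trans (Lphi _ _) (le_trans _ H).
  rewrite mulrC ler_wpM2l //; apply: le_trans (ler_norm _) _; lra.
exists (`|phi 0| + `|L|), 1 => t; rewrite mul1r.
have -> : phi t = phi 0 + (phi t - phi 0) by rewrite addrC subrK.
apply: le_trans (ler_normD _ _) _; rewrite mulrDl lerD //.
  by rewrite ler_peMr // -[leLHS]expR0 ler_expR.
apply: le_trans (Lphi _ _) _; rewrite subr0.
apply: le_trans (ler_wpM2r (normr_ge0 _) (ler_norm _)) _.
rewrite ler_wpM2l //; apply: le_trans (expR_ge1Dx _); rewrite lerDr ?ler01 //.
Qed.

Lemma tame_shift phi b c : tame phi -> tame (fun t => phi (b + c * t)).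
Proof.
move=> tphi; have [B [k [B0 k0 Bk]]] := tame_norm_bound tphi; split.
  move=> t; apply: (@continuous_comp _ _ _ (fun t => b + c * t) phi).
    apply: cvgD; first exact: cvg_cst.
    by apply: cvgM; [exact: cvg_cst|exact: cvg_id].
  exact: tame_continuous.
exists (B * expR (k * `|b|)), (k * `|c|) => t; apply: le_trans (Bk _) _.
rewrite -mulrA ler_wpM2l // -expRD ler_expR -mulrA -normrM -mulrDr.
by rewrite ler_wpM2l // ler_normD.
Qed.

Lemma exp_coeff_sum_le x n : 0 <= x ->
  \sum_(i < n) x ^+ i / i`!%:R <= expR x.
Proof.
move=> x0; rewrite -(big_mkord xpredT (fun i => x ^+ i / i`!%:R)).
apply: (nondecreasing_cvgn_le (u_ := series (exp_coeff x))).
  by apply: nondecreasing_series => i _ _; rewrite exp_coeff_ge0.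
exact: is_cvg_series_exp_coeff.
Qed.

Lemma pow_fact_le x n : 0 <= x -> x ^+ n / n`!%:R <= expR x.
Proof.
move=> x0; apply: le_trans (exp_coeff_sum_le n.+1 x0).
rewrite big_ord_recr /= lerDr; apply: sumr_ge0 => i _.
by rewrite divr_ge0 // exprn_ge0.
Qed.

(** The coefficients after the [n]-th are compared with those of [x^n / n! *
    exp x], using that [n! * i!] divides [(n + i)!]. *)
Lemma exp_remainder x n :
  `|expR x - \sum_(i < n) x ^+ i / i`!%:R| <= `|x| ^+ n / n`!%:R * expR `|x|.
Proof.
have cx : `|series (exp_coeff x) k - \sum_(i < n) x ^+ i / i`!%:R| @[k --> \oo]
    --> `|expR x - \sum_(i < n) x ^+ i / i`!%:R|.
  apply: cvg_norm; apply: cvgB; last exact: cvg_cst.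
  exact: is_cvg_series_exp_coeff.
rewrite -(cvg_lim _ cx) //; apply: limr_le; first exact: cvgP cx.
exists n => // k /= nk; rewrite /series /=.
rewrite (@big_cat_nat _ _ _ n 0 k) //= big_mkord addrAC subrr add0r.
apply: le_trans (ler_norm_sum _ _ _) _.
have -> : k = ((k - n) + n)%N by rewrite subnK.
rewrite -{1}(add0n n) big_addn addnK.
apply: (@le_trans _ _ (`|x| ^+ n / n`!%:R * \sum_(i < k - n) `|x| ^+ i /
  i`!%:R)).
  rewrite big_mkord mulr_sumr; apply: ler_sum => i _.
  rewrite /exp_coeff /= normrM normrX normfV (ger0_norm (ler0n _ _)) exprD.
  rewrite mulrACA [X in X * _]mulrC ler_wpM2l ?mulr_ge0 ?exprn_ge0 //.
  rewrite -invfM -natrM lef_pV2 ?posrE ?ltr0n ?muln_gt0 ?fact_gt0 //.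
  rewrite ler_nat dvdn_leq ?fact_gt0 //.
  by rewrite -(bin_fact (leq_addl i n)) addnK dvdn_mull.
by rewrite ler_wpM2l ?divr_ge0 ?exprn_ge0 // exp_coeff_sum_le.
Qed.

Lemma tame_pow n : tame (fun t => t ^+ n / n`!%:R).
Proof.
split.
  move=> t; apply: cvgM; last exact: cvg_cst.
  exact: exprn_continuous.
exists 1, 1 => t; rewrite !mul1r normrM normrX normfV (ger0_norm (ler0n _ _)).
exact: pow_fact_le.
Qed.

Lemma gauss_mean_norm_le phi psi : tame phi -> tame psi ->
  (forall t, `|phi t| <= psi t) -> `|gauss_mean phi| <= gauss_mean psi.
Proof.
move=> tphi tpsi H; rewrite ler_norml; apply/andP; split; last first.
  by apply: gauss_mean_le => // t; exact: le_trans (ler_norm _) (H t).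
rewrite -mulN1r -gauss_meanZ //; apply: gauss_mean_le =>
  //; first exact: tameM (tame_cst _) _.
by move=> t; have := H t; rewrite mulN1r ler_norml => /andP[].
Qed.

Let gauss_mean_shift_nneg phi b : tame phi -> (forall t, 0 <= phi t) ->
  gauss_mean (fun t => phi (b + t)) =
    expR (- b ^+ 2 / 2) * gauss_mean (fun t => phi t * expR (b * t)).
Proof.
move=> tphi phi0; rewrite -gauss_meanZ; last exact: tameM (tame_exp _).
have Db : derive1 (fun x : R => b + x) = cst 1.
  apply/funext => x; rewrite derive1E deriveD // derive_cst derive_id add0r //.
rewrite /gauss_mean /Rintegral; congr fine; apply/esym.
transitivity (\int[mu]_t (phi t * p (t - b))%:E)%E.
  by apply: eq_integral => t _; congr EFin; rewrite p_shift; ring.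
rewrite (@increasing_ge0_integration_by_substitutionT _ (fun x => b + x)) //.
- apply: eq_integral => t _; rewrite Db /=; congr EFin.
  by rewrite !fctE /= mulr1 (_ : b + t - b = t) //; ring.
- by move=> x y; rewrite ltrD2l.
- by rewrite Db => ?; exact: cvg_cst.
- by rewrite Db; exact: is_cvg_cst.
- by rewrite Db; exact: is_cvg_cst.
- exact: cvg_addrl_Ny.
- exact: cvg_addrl.
- move=> t; apply: cvgM; first exact: tame_continuous.
  apply: (@continuous_comp _ _ _ (fun t => t - b) p); last exact: p_continuous.
  by apply: cvgB; [exact: cvg_id|exact: cvg_cst].
- by move=> t; rewrite mulr_ge0.
Qed.

(** Translate the integration variable and expand the square in the density.
    Any tame function is the difference of two nonnegative ones, for which
    the translation of the variable is available. *)
Lemma gauss_mean_shift phi b : tame phi ->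
  gauss_mean (fun t => phi (b + t)) =
    expR (- b ^+ 2 / 2) * gauss_mean (fun t => phi t * expR (b * t)).
Proof.
move=> tphi; have [B [k [B0 k0 Bk]]] := tame_norm_bound tphi.
(* A nonnegative tame function with [phi + psi] nonnegative. *)
pose psi t := B * expR (k * `|t|).
have tpsi : tame psi by apply: tameM; [exact: tame_cst|exact: tame_exp_abs].
have psi0 t : 0 <= psi t by rewrite mulr_ge0 ?expR_ge0.
have ts := tameD tphi tpsi.
have sh f : tame f -> tame (fun t => f (b + t)).
  by move=> /(tame_shift b 1); congr tame; apply/funext => t; rewrite mul1r.
have me f : tame f -> tame (fun t => f t * expR (b * t)).
  by move=> tf; apply: tameM => //; exact: tame_exp.
have H1 := gauss_mean_shift_nneg b tpsi psi0.
have H2 : gauss_mean (fun t => phi (b + t) + psi (b + t)) =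
    expR (- b ^+ 2 / 2) * gauss_mean (fun t =>
      phi t * expR (b * t) + psi t * expR (b * t)).
  have := gauss_mean_shift_nneg b ts; rewrite /= => -> //; last first.
    by move=> t; have := Bk t; rewrite ler_norml =>
      /andP[+ _]; rewrite lerNl -subr_ge0 opprK addrC.
  by congr (_ * gauss_mean _); apply/funext => t; rewrite mulrDl.
move: H2; rewrite (gauss_meanD (sh _ tphi) (sh _ tpsi))
  (gauss_meanD (me _ tphi) (me _ tpsi)).
by rewrite mulrDr H1 => /addIr.
Qed.

Lemma tame_tilt_sum phi b n : tame phi ->
  tame (fun t => \sum_(i < n) b ^+ i * (phi t * (t ^+ i / i`!%:R))).
Proof.
move=> tphi; elim: n => [|n IHn].
  by have := tame_cst 0; congr tame; apply/funext => t; rewrite big_ord0.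
have tp : tame (fun t => phi t * (t ^+ n / n`!%:R)).
  by apply: tameM => //; exact: tame_pow.
have := tameD IHn (tameM (tame_cst (b ^+ n)) tp).
by congr tame; apply/funext => t; rewrite big_ord_recr.
Qed.

(** The remainder of the exponential series of [b * t] is at most [2^-n *
    |t|^n / n! * exp (|t| / 2)] when [|b| <= 1/2]. *)
Lemma gauss_mean_exp_series phi b B n : tame phi -> `|b| <= 2^-1 ->
  (forall t, `|phi t| <= B * expR `|t|) ->
  `|gauss_mean (fun t => phi t * expR (b * t)) -
    \sum_(i < n) b ^+ i * gauss_mean (fun t => phi t * (t ^+ i / i`!%:R))| <=
  gauss_mean (fun t => B * expR (3 * `|t|)) * 2^-1 ^+ n.
Proof.
move=> tphi b2 Bphi.
have tp i : tame (fun t => phi t * (t ^+ i / i`!%:R)).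
  by apply: tameM => //; exact: tame_pow.
have tD : tame (fun t => B * expR (3 * `|t|)).
  by apply: tameM; [exact: tame_cst|exact: tame_exp_abs].
have tS := tame_tilt_sum b n tphi.
have ES : \sum_(i < n) b ^+ i * gauss_mean (fun t =>
  phi t * (t ^+ i / i`!%:R)) =
    gauss_mean (fun t => \sum_(i < n) b ^+ i * (phi t * (t ^+ i / i`!%:R))).
  elim: n {tS} => [|n IHn].
    rewrite big_ord0 -[LHS](gauss_mean_cst 0); congr gauss_mean.
    by apply/funext => t; rewrite big_ord0.
  rewrite big_ord_recr /= IHn -gauss_meanZ // -gauss_meanD //; last 2 first.
  - exact: tame_tilt_sum.
  - exact: tameM (tame_cst _) (tp n).
  by congr gauss_mean; apply/funext => t; rewrite big_ord_recr.
rewrite ES -mulN1r -gauss_meanZ // -gauss_meanD //; last 2 first.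
  by apply: tameM => //; exact: tame_exp.
  exact: tameM (tame_cst _) tS.
rewrite mulrC -gauss_meanZ //; apply: gauss_mean_norm_le.
- apply: tameD; first by apply: tameM => //; exact: tame_exp.
  exact: tameM (tame_cst _) tS.
- exact: tameM (tame_cst _) tD.
move=> t.
have -> : phi t * expR (b * t) + -1 * \sum_(i < n) b ^+ i * (phi t *
  (t ^+ i / i`!%:R)) =
   phi t * (expR (b * t) - \sum_(i < n) (b * t) ^+ i / i`!%:R).
  rewrite mulrBr mulN1r mulr_sumr; congr (_ - _); apply: eq_bigr => i _.
  by rewrite exprMn; ring.
rewrite normrM.
apply: le_trans (ler_pM (normr_ge0 _) (normr_ge0 _) (Bphi t)
  (exp_remainder _ _)) _.
have -> : 2^-1 ^+ n * (B * expR (3 * `|t|)) =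
   B * expR `|t| * (2^-1 ^+ n * expR `|t| * expR `|t|).
  have -> : 3 * `|t| = `|t| + (`|t| + `|t|) by ring.
  by rewrite !expRD; ring.
have BB : 0 <= B * expR `|t| by apply: le_trans (Bphi t).
rewrite ler_wpM2l //; apply: ler_pM.
- by rewrite mulr_ge0 ?exprn_ge0.
- exact: expR_ge0.
- rewrite normrM exprMn -mulrA; apply: ler_pM.
  + by rewrite exprn_ge0.
  + by rewrite mulr_ge0 ?exprn_ge0.
  + by rewrite lerXn2r ?nnegrE.
  + exact: pow_fact_le.
- rewrite ler_expR normrM -[leRHS]mul1r ler_wpM2r //; lra.
Qed.

End Gauss.

(** * Orthonormal systems and tails *)

Definition inner_product {R : realType} {X : normedModType R} (ip : X -> X ->
    R) :=
  [/\ forall y, scalar (ip^~ y), forall x y, ip x y = ip y x &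
      forall x, ip x x = `|x| ^+ 2].

Lemma dot_inner_product (R : realType) (X : normedModType R)
    (dot : {dot X for idfun}) :
  (forall x : X, `|x| = Num.sqrt (dot x x)) -> inner_product dot.
Proof.
move=> norm_dot; split.
- by move=> y a u v; rewrite linearPl.
- by move=> x y; rewrite [LHS](@hermitian_subproof _ _ _ _ dot) expr0 mul1r.
- move=> x; rewrite norm_dot sqr_sqrtr //.
  have [->|x0] := eqVneq x 0; first by rewrite linear0l.
  exact/ltW/neq0_dnorm_gt0.
Qed.

Section Orthonormal.
Context {R : realType} {X : normedModType R} (ip : X -> X -> R).
Context (ip_inner : inner_product ip).
Implicit Types (x y z : X) (e : nat -> X).

Lemma ipC x y : ip x y = ip y x. Proof. by case: ip_inner. Qed.

Lemma ip_norm x : ip x x = `|x| ^+ 2. Proof. by case: ip_inner. Qed.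

Lemma ipPl y : scalar (ip^~ y). Proof. by case: ip_inner. Qed.

Lemma ipPr x : scalar (ip x).
Proof. by move=> a y z; rewrite ipC ipPl !(ipC x). Qed.

Lemma ipDl y x z : ip (x + z) y = ip x y + ip z y.
Proof. by have := ipPl y 1 x z; rewrite scale1r mul1r. Qed.

Lemma ip0l y : ip 0 y = 0.
Proof. by have := ipDl y 0 0; rewrite addr0 =>
  /eqP; rewrite -subr_eq0 opprD addNKr oppr_eq0 => /eqP. Qed.

Lemma ipZl a x y : ip (a *: x) y = a * ip x y.
Proof. by have := ipPl y a x 0; rewrite !addr0 ip0l addr0. Qed.

Lemma ipNl x y : ip (- x) y = - ip x y.
Proof. by rewrite -scaleN1r ipZl mulN1r. Qed.

Lemma ipBl y x z : ip (x - z) y = ip x y - ip z y.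
Proof. by rewrite ipDl ipNl. Qed.

Lemma ipDr y x z : ip y (x + z) = ip y x + ip y z.
Proof. by rewrite ipC ipDl !(ipC y). Qed.

Lemma ipZr a x y : ip x (a *: y) = a * ip x y.
Proof. by rewrite ipC ipZl ipC. Qed.

Lemma ipBr y x z : ip y (x - z) = ip y x - ip y z.
Proof. by rewrite ipC ipBl !(ipC y). Qed.

Lemma ip_suml n (F : nat -> X) y : ip (\sum_(i < n) F i) y =
    \sum_(i < n) ip (F i) y.
Proof.
elim: n => [|n IHn]; first by rewrite !big_ord0 ip0l.
by rewrite !big_ord_recr /= ipDl IHn.
Qed.

Lemma cauchy_schwarz x y : `|ip x y| <= `|x| * `|y|.
Proof.
have [->|y0] := eqVneq y 0; first by rewrite ipC ip0l !normr0 mulr0.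
have yp : 0 < `|y| by rewrite normr_gt0.
rewrite -(@ler_pXn2r _ 2) ?nnegrE ?mulr_ge0 // real_normK ?num_real // exprMn.
pose t := ip x y / `|y| ^+ 2.
have : 0 <= `|x - t *: y| ^+ 2 by rewrite exprn_ge0.
rewrite -ip_norm ipBl !ipBr !ipZl !ipZr !ip_norm (ipC y x).
have -> : `|x| ^+ 2 - t * ip x y - (t * ip x y - t * (t * `|y| ^+ 2)) =
   `|x| ^+ 2 - ip x y ^+ 2 / `|y| ^+ 2.
  by rewrite /t; field; rewrite gt_eqF.
by rewrite subr_ge0 ler_pdivrMr // exprn_gt0.
Qed.

(** Zero vectors are allowed, so that no case distinction on the dimension of
    [X] or on linear dependence in the Gram-Schmidt process is needed. *)
Definition orthonormal_system e :=
  (forall i j, i != j -> ip (e i) (e j) = 0) /\ (forall i, e i = 0 \/ `|e i| =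
    1).

Definition tail e n x := x - \sum_(i < n) ip x (e i) *: e i.

Section System.
Context (e : nat -> X) (one : orthonormal_system e).

Lemma tail0 x : tail e 0 x = x.
Proof. by rewrite /tail big_ord0 subr0. Qed.

Lemma tailS n x : tail e n.+1 x = tail e n x - ip x (e n) *: e n.
Proof. by rewrite /tail big_ord_recr /= opprD addrA. Qed.

Lemma ip_tail n x j : ip (tail e n x) (e j) =
  if (j < n)%N then 0 else ip x (e j).
Proof.
have [ort nrm] := one.
elim: n => [|n IHn]; first by rewrite tail0.
rewrite tailS ipBl ipZl IHn ltnS.
have [jn|nj|->] := ltngtP j n.
- by rewrite (ort n j) ?gtn_eqF // mulr0 subr0.
- by rewrite (ort n j) ?ltn_eqF // mulr0 subr0.
- rewrite ip_norm; case: (nrm n) => E; last by rewrite E expr1n mulr1 subrr.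
  by rewrite E normr0 expr0n mulr0 ipC ip0l subrr.
Qed.

Lemma tail_sqr n x : `|tail e n.+1 x| ^+ 2 =
    `|tail e n x| ^+ 2 - ip x (e n) ^+ 2.
Proof.
have [ort nrm] := one.
rewrite -!ip_norm tailS; have := ip_tail n x n; rewrite ltnn.
move: (tail e n x) => t tx.
rewrite ipBl !ipBr !ipZl !ipZr (ipC (e n) t) tx (ip_norm (e n)).
case: (nrm n) => E; last by rewrite E; ring.
by rewrite E normr0 (ipC _ 0) ip0l; ring.
Qed.

Lemma tail_le n x : `|tail e n x| <= `|x|.
Proof.
elim: n => [|n IHn]; first by rewrite tail0.
apply: le_trans IHn; rewrite -(@ler_pXn2r _ 2) ?nnegrE // tail_sqr.
by rewrite gerBl sqr_ge0.
Qed.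

Lemma tailB n x y : tail e n (x - y) = tail e n x - tail e n y.
Proof.
elim: n => [|n IHn]; first by rewrite !tail0.
rewrite !tailS IHn ipBl scalerBl !opprB addrACA [RHS]addrACA.
by congr (_ + _); exact: addrC.
Qed.

Lemma bessel n x : \sum_(i < n) ip x (e i) ^+ 2 <= `|x| ^+ 2.
Proof.
have -> : \sum_(i < n) ip x (e i) ^+ 2 = `|x| ^+ 2 - `|tail e n x| ^+ 2.
  elim: n => [|n IHn]; first by rewrite big_ord0 tail0 subrr.
  by rewrite big_ord_recr /= IHn tail_sqr; ring.
by rewrite gerBl sqr_ge0.
Qed.

Lemma norm_combination n (c : nat -> R) :
  `|\sum_(i < n) c i *: e i| ^+ 2 <= \sum_(i < n) c i ^+ 2.
Proof.
have [ort nrm] := one.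
elim: n => [|n IHn]; first by rewrite !big_ord0 normr0 expr0n.
rewrite !big_ord_recr /= -ip_norm ipDl !ipDr ip_norm.
have S0 : ip (\sum_(i < n) c i *: e i) (e n) = 0.
  rewrite (ip_suml n (fun i => c i *: e i)) big1 // => i _.
  by rewrite ipZl (ort i n) ?mulr0 // ltn_eqF.
rewrite ipZr S0 (ipC (c n *: e n)) ipZr S0 !mulr0 addr0 add0r lerD //.
rewrite ipZl ipZr ip_norm mulrA -expr2; case: (nrm n) => ->.
  by rewrite normr0 expr0n mulr0 sqr_ge0.
by rewrite expr1n mulr1.
Qed.

End System.

(** The orthonormalisation of the first [n] vectors; a vector that depends on
    the previous ones contributes [0], since the inverse of [0] is [0]. *)
Fixpoint gram_schmidt (d : nat -> X) (n : nat) : seq X :=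
  if n is n'.+1 then
    let s := gram_schmidt d n' in
    let r := d n' - \sum_(i < n') ip (d n') (nth 0 s i) *: nth 0 s i in
    rcons s (`|r|^-1 *: r)
  else [::].

Lemma exists_orthonormal (d : nat -> X) : exists e, orthonormal_system e /\
  forall n, tail e n.+1 (d n) = 0.
Proof.
pose e n := nth 0 (gram_schmidt d n.+1) n.
have size_gs n : size (gram_schmidt d n) = n.
  by elim: n => //= n IHn; rewrite size_rcons IHn.
have nth_gs n i : (i < n)%N -> nth 0 (gram_schmidt d n) i = e i.
  elim: n => // n IHn; rewrite ltnS leq_eqVlt => /predU1P[->//|ni].
  by rewrite /= nth_rcons size_gs ni IHn.
have eE n : e n = `|tail e n (d n)|^-1 *: tail e n (d n).
  rewrite {1}/e /= nth_rcons size_gs ltnn eqxx.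
  suff -> : d n - \sum_(i < n) ip (d n)
    (nth 0 (gram_schmidt d n) i) *: nth 0 (gram_schmidt d n) i =
      tail e n (d n) by [].
  by rewrite /tail; congr (_ - _); apply: eq_bigr => i _; rewrite nth_gs.
have nrm i : e i = 0 \/ `|e i| = 1.
  rewrite eE; have [->|t0] := eqVneq (tail e i (d i)) 0.
    by left; rewrite scaler0.
  by right; rewrite normrZ normfV normr_id mulVf // normr_eq0.
have ort n : forall j, (j < n)%N -> ip (e n) (e j) = 0.
  elim/ltn_ind: n => n IHn j jn.
  rewrite eE ipZl; apply/eqP; rewrite mulf_eq0; apply/orP; right; apply/eqP.
  rewrite /tail ipBl (ip_suml n (fun i => ip (d n) (e i) *: e i)).
  rewrite (bigD1 (Ordinal jn)) //= big1 ?addr0; last first.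
    move=> i; rewrite -val_eqE /= => ij; rewrite ipZl.
    case: (ltngtP i j) ij => // ij _; last by rewrite IHn // mulr0.
    by rewrite (ipC (e i)) IHn ?mulr0.
  rewrite ipZl ip_norm; case: (nrm j) => ->; last by rewrite expr1n mulr1 subrr.
  by rewrite ipC ip0l mul0r subrr.
have on : orthonormal_system e.
  split=> // i j; case: (ltngtP i j) => // ij _; last exact: ort.
  by rewrite ipC ort.
exists e; split=> // n; rewrite tailS.
have [t0|t0] := eqVneq (tail e n (d n)) 0.
  by rewrite [X in _ - _ *: X]eE t0 !scaler0 subr0.
have := ip_tail on n (d n) n; rewrite ltnn => <-.
set t := tail e n (d n) in t0 *.
have tn : `|t| != 0 by rewrite normr_eq0.
rewrite eE -/t ipZr ip_norm scalerA expr2 mulrA mulVf // mul1r mulfV // scale1r.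
exact: subrr.
Qed.

Lemma exists_total_orthonormal : separable_space X ->
  exists2 e, orthonormal_system e & forall x, `|tail e n x| @[n --> \oo] --> 0.
Proof.
move=> [D cD dD].
have [d0 Dd0] : exists d0, D d0.
  by have [z [_ Dz]] := dD setT (ex_intro _ 0 I) openT; exists z.
have [d Hd] : exists d : nat -> X, forall y, D y -> exists n, d n = y.
  have /countable_injP[f finj] := cD.
  exists (fun n => xget d0 [set y | D y /\ f y = n]) => y Dy; exists (f y).
  have [] : [set y' | D y' /\ f y' = f y] (xget d0 [set y' | D y' /\ f y' =
    f y]).
    by apply: (@xgetPex _ d0); exists y.
  by move=> Dg; apply: finj; rewrite inE.
have [e [on td]] := exists_orthonormal d.
exists e => // x; apply/cvgrPdist_le => eps eps0.
have [z [Bz Dz]] := dD (ball x eps) (ex_intro _ x (ballxx x eps0))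
  (ball_open x eps).
have [n dn] := Hd _ Dz.
have tdn k : (n < k)%N -> tail e k (d n) = 0.
  (* A tail that vanishes once vanishes from there on. *)
  elim: k => // k IHk; rewrite ltnS leq_eqVlt =>
    /predU1P[<-|nk]; first exact: td.
  have := ip_tail on k (d n) k; rewrite ltnn IHk // ip0l => E.
  by rewrite tailS IHk // -E scale0r subr0.
exists n.+1 => // k /= nk; rewrite sub0r normrN normr_id.
have -> : tail e k x = tail e k (x - d n) by rewrite tailB tdn // subr0.
apply: le_trans (tail_le on _ _) _; rewrite dn.
by move: Bz; rewrite -ball_normE /= => /ltW.
Qed.

End Orthonormal.

(** * A damping function that varies slowly on the logarithmic scale *)

Section Damping.
Context {R : realType}.
Implicit Types (d s t u : R) (m n : nat).

Lemma four_exp n : 4 ^+ n = (2 ^+ n) ^+ 2 :> R.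
Proof. by rewrite -exprM mulnC exprM (_ : 2 ^+ 2 = 4) //; ring. Qed.

(** An analytic substitute for the positive part of [t - 1]. For [t] away from
    [1] its error is of order [d]. *)
Definition soft_excess d t : R := (t - 1 + Num.sqrt ((t - 1) ^+ 2 + d)) / 2.

Lemma soft_excess_sqrt d t : 0 < d ->
    exists S, [/\ 0 < S, S ^+ 2 = (t - 1) ^+ 2 + d &
  soft_excess d t = (t - 1 + S) / 2].
Proof.
move=> d0; exists (Num.sqrt ((t - 1) ^+ 2 + d)).
have h : 0 < (t - 1) ^+ 2 + d by rewrite ltr_wpDl ?sqr_ge0.
by rewrite sqrtr_gt0 sqr_sqrtr // ltW.
Qed.

Lemma soft_excess_ge0 d t : 0 < d -> 0 <= soft_excess d t.
Proof.
move=> d0; have [S [S0 S2 ->]] := soft_excess_sqrt t d0.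
rewrite divr_ge0 //; nra.
Qed.

Lemma soft_excess_ge d t : 0 < d -> t - 1 <= soft_excess d t.
Proof.
move=> d0; have [S [S0 S2 ->]] := soft_excess_sqrt t d0.
rewrite ler_pdivlMr //; nra.
Qed.

Lemma soft_excess_lipschitz d t t' : 0 < d -> t <= t' ->
  0 <= soft_excess d t' - soft_excess d t <= t' - t.
Proof.
move=> d0 tt; have [S [S0 S2 ->]] := soft_excess_sqrt t d0.
have [S' [S'0 S2' ->]] := soft_excess_sqrt t' d0.
have H : `|S' - S| <= t' - t.
  have SS : 0 < S' + S by rewrite addr_gt0.
  rewrite -(ler_pM2r SS) -{1}(ger0_norm (ltW SS)) -normrM -subr_sqr S2 S2'.
  have -> : (t' - 1) ^+ 2 + d - ((t - 1) ^+ 2 + d) =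
    (t' - t) * ((t' - 1) + (t - 1)).
    by ring.
  rewrite normrM ger0_norm ?subr_ge0 // ler_wpM2l ?subr_ge0 //.
  apply: le_trans (ler_normD _ _) _.
  apply: lerD; rewrite -(@ler_pXn2r _ 2) ?nnegrE ?(ltW S0) ?(ltW S'0) //
    real_normK ?num_real //.
  - by rewrite S2' lerDl ltW.
  - by rewrite S2 lerDl ltW.
move: H; rewrite ler_norml => /andP[H1 H2]; apply/andP; split; lra.
Qed.

(** The mean of the [m] functions [4^k / (4^k + u)], which fall from [1] to
    [0] around [u = 4^k]. In the variable [log u] the mean is therefore a
    descent of slope about [1 / m] over a range of length about [m]. *)
Definition damping m u : R := m%:R^-1 * \sum_(k < m) (4 ^+ k / (4 ^+ k + u)).

Lemma damping_le1 m u : 0 <= u -> damping m u <= 1.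
Proof.
move=> u0; rewrite /damping; case: m => [|m]; first by rewrite big_ord0 mulr0.
rewrite ler_pdivrMl ?ltr0n // mulr1.
apply: (@le_trans _ _ (\sum_(k < m.+1) 1)); last by rewrite sumr_const card_ord.
apply: ler_sum => k _.
have q0 : 0 < 4 ^+ k :> R by rewrite exprn_gt0.
by rewrite ler_pdivrMr ?mul1r ?lerDl // ltr_wpDr.
Qed.

Lemma damping_ge0 m u : 0 <= u -> 0 <= damping m u.
Proof.
move=> u0; rewrite mulr_ge0 ?invr_ge0 //; apply: sumr_ge0 => k _.
by rewrite divr_ge0 ?addr_ge0 ?exprn_ge0.
Qed.

(** Each of the [m] functions is [1 - u / (4^k + u)]. *)
Lemma damping_compl_le m u : (0 < m)%N -> 0 <= u -> 1 - damping m u <= u.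
Proof.
move=> m0 u0; suff : 1 - u <= damping m u by lra.
rewrite ler_pdivlMl ?ltr0n //.
apply: (@le_trans _ _ (\sum_(k < m) (1 - u))).
  by rewrite sumr_const card_ord -[leRHS]mulr_natl.
apply: ler_sum => k _.
have q0 : 1 <= 4 ^+ k :> R by rewrite exprn_ege1 //; lra.
rewrite ler_pdivlMr; last by lra.
nra.
Qed.

Lemma damping_decay m u : (0 < m)%N -> 0 <= u ->
    damping m u <= 4 ^+ m / (4 ^+ m + u).
Proof.
move=> m0 u0; rewrite ler_pdivrMl ?ltr0n //.
apply: (@le_trans _ _ (\sum_(k < m) (4 ^+ m / (4 ^+ m + u)))); last first.
  by rewrite sumr_const card_ord -[leLHS]mulr_natl.
apply: ler_sum => k _.
have q0 : 0 < 4 ^+ k :> R by rewrite exprn_gt0.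
have Q0 : 0 < 4 ^+ m :> R by rewrite exprn_gt0.
have qQ : 4 ^+ k <= 4 ^+ m :> R by rewrite ler_eXn2l ?ltr1n // ltnW.
rewrite ler_pdivrMr ?ltr_wpDr // mulrAC ler_pdivlMr ?ltr_wpDr //.
nra.
Qed.

(** In the variable [s = sqrt (1 + u)] this is about [1 / (m s)] for [1 <= s
    <= 2^m], and it decays faster beyond. *)
Definition damping_slope m s : R :=
    16 / m%:R * (2 ^+ m / ((s + 1) * (s + 2 ^+ m))).

(** With [y = 2^k] the [k]-th function has slope at most [4 y / (y^2 + s^2)]
    between [s] and any larger point. This is at most [16 ((s + y)^-1 - (s + 2
    y)^-1)], which telescopes over [k]. The bound involves the smaller point
    only; that is what makes [trunc_coef_dist] work. *)
Lemma damping_lipschitz m s s' : (0 < m)%N -> 1 <= s -> s <= s' ->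
  0 <= damping m (s ^+ 2 - 1) - damping m (s' ^+ 2 - 1) <=
    damping_slope m s * (s' - s).
Proof.
move=> m0 s1 ss.
have term (k : nat) : let q : R := 4 ^+ k in let y : R := 2 ^+ k in
  0 <= q / (q + (s ^+ 2 - 1)) - q / (q + (s' ^+ 2 - 1)) <=
  16 * ((s + y)^-1 - (s + 2 * y)^-1) * (s' - s).
  move=> q y; have y1 : 1 <= y by rewrite exprn_ege1 //; lra.
  have qE : q = y ^+ 2 by exact: four_exp.
  rewrite qE.
  have h1 : 0 < y ^+ 2 + (s ^+ 2 - 1) by nra.
  have h2 : 0 < y ^+ 2 + (s' ^+ 2 - 1) by nra.
  have -> : y ^+ 2 / (y ^+ 2 + (s ^+ 2 - 1)) - y ^+ 2 / (y ^+ 2 +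
    (s' ^+ 2 - 1)) =
     (y ^+ 2 * (s' + s)) / ((y ^+ 2 + (s ^+ 2 - 1)) * (y ^+ 2 +
       (s' ^+ 2 - 1))) * (s' - s).
    by field; rewrite !gt_eqF.
  have -> : (s + y)^-1 - (s + 2 * y)^-1 = y / ((s + y) * (s + 2 * y)).
    by field; apply/andP; split; rewrite gt_eqF //; lra.
  apply/andP; split.
    rewrite mulr_ge0 ?subr_ge0 // divr_ge0 ?mulr_ge0 ?(ltW h1) ?(ltW h2) //;
      lra.
  rewrite ler_wpM2r ?subr_ge0 // ler_pdivrMr ?mulr_gt0 //.
  rewrite [16 * (_ / _)]mulrA [leRHS]mulrAC ler_pdivlMr;
    last by rewrite mulr_gt0 //; lra.
  have yy : 1 <= y ^+ 2 by rewrite exprn_ege1.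
  have ss1 : 1 <= s ^+ 2 by rewrite exprn_ege1.
  have ss2 : 1 <= s' ^+ 2 by rewrite exprn_ege1 // (le_trans s1).
  have e1 : y * (s' + s) <= 2 * (y ^+ 2 + (s' ^+ 2 - 1)).
    have := sqr_ge0 (y - s'); have : 0 <=
      y * (s' - s) by rewrite mulr_ge0 ?subr_ge0 //; lra.
    by nra.
  have e2 : (s + y) * (s + 2 * y) <= 8 * (y ^+ 2 + (s ^+ 2 - 1)).
    by have := sqr_ge0 (y - s); nra.
  have -> : y ^+ 2 * (s' + s) * ((s + y) * (s + 2 * y)) =
     y * ((y * (s' + s)) * ((s + y) * (s + 2 * y))) by ring.
  have -> : 16 * y * ((y ^+ 2 + (s ^+ 2 - 1)) * (y ^+ 2 + (s' ^+ 2 - 1))) =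
    y * ((2 * (y ^+ 2 + (s' ^+ 2 - 1))) * (8 * (y ^+ 2 +
      (s ^+ 2 - 1)))) by ring.
  rewrite ler_wpM2l //; first by lra.
  by apply: ler_pM => //; rewrite mulr_ge0 //; lra.
rewrite /damping -mulrBr -sumrB; apply/andP; split.
  rewrite mulr_ge0 ?invr_ge0 //; apply: sumr_ge0 => k _.
  by have /andP[] := term k.
have tele n : \sum_(k < n) ((s + 2 ^+ k)^-1 - (s + 2 * 2 ^+ k)^-1) =
    (s + 1)^-1 - (s + 2 ^+ n)^-1.
  elim: n => [|n IHn]; first by rewrite big_ord0 expr0 subrr.
  by rewrite big_ord_recr /= IHn exprS; ring.
apply: (@le_trans _ _ (m%:R^-1 * (16 * ((s + 1)^-1 - (s +
  2 ^+ m)^-1) * (s' - s)))).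
  rewrite ler_wpM2l ?invr_ge0 // -tele mulr_sumr mulr_suml.
  by apply: ler_sum => k _; have /andP[] := term k.
have M1 : 1 <= 2 ^+ m :> R by rewrite exprn_ege1 //; lra.
have -> : damping_slope m s * (s' - s) =
    m%:R^-1 * (16 * (2 ^+ m / ((s + 1) * (s + 2 ^+ m))) * (s' - s)).
  by rewrite /damping_slope; ring.
rewrite ler_wpM2l ?invr_ge0 // ler_wpM2r ?subr_ge0 // ler_wpM2l //.
have -> : (s + 1)^-1 - (s + 2 ^+ m)^-1 =
  (2 ^+ m - 1) / ((s + 1) * (s + 2 ^+ m)).
  by field; apply/andP; split; rewrite gt_eqF //; lra.
by rewrite ler_wpM2r ?invr_ge0 ?mulr_ge0 //; lra.
Qed.

Definition slope_kernel m t : R := 4 ^+ m / ((1 + t) * (4 ^+ m + t)).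

Lemma damping_slope_sqr_le m s t : (0 < m)%N -> 1 <= s -> 0 <= t ->
    t <= s ^+ 2 ->
  damping_slope m s ^+ 2 <= 256 / m%:R ^+ 2 * slope_kernel m t.
Proof.
move=> m0 s1 t0 ts; rewrite /damping_slope exprMn exprMn exprVn (_ : 16 ^+ 2 =
  256); last by ring.
rewrite ler_wpM2l ?divr_ge0 ?exprn_ge0 // /slope_kernel.
have y1 : 1 <= 2 ^+ m :> R by rewrite exprn_ege1 //; lra.
rewrite four_exp.
set y : R := 2 ^+ m in y1 *.
rewrite exprMn exprVn ler_wpM2l ?sqr_ge0 // lef_pV2 ?posrE.
- rewrite exprMn; apply: ler_pM; nra.
- by rewrite mulr_gt0 //; nra.
- by rewrite mulr_gt0 //; nra.
Qed.

(** Up to the factor [2], [slope_kernel m] is the derivative of [ln ((1 + t) /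
    (4^m + t))]; the inequality follows from [1 - 1/x <= ln x]. *)
Lemma slope_kernel_step m t t' : (0 < m)%N -> 0 <= t' -> t' <= t ->
  slope_kernel m t * (t - t') <=
  2 * (ln ((1 + t) / (4 ^+ m + t)) - ln ((1 + t') / (4 ^+ m + t'))).
Proof.
move=> m0 t'0 tt.
have M4 : 4 <= 4 ^+ m :> R by rewrite -[leLHS]expr1 ler_eXn2l ?ltr1n.
rewrite /slope_kernel; set M : R := 4 ^+ m in M4 *.
have a1 : 0 < (1 + t) / (M + t) by rewrite divr_gt0 //; lra.
have a2 : 0 < (1 + t') / (M + t') by rewrite divr_gt0 //; lra.
rewrite -ln_div ?posrE //.
set x := _ / _ / _.
have x0 : 0 < x by rewrite divr_gt0.
have H : 1 - x^-1 <= ln x.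
  have := expR_ge1Dx (ln x^-1).
  by rewrite lnK ?posrE ?invr_gt0 // lnV ?posrE //; lra.
apply: (@le_trans _ _ (2 * (1 - x^-1))); last by rewrite ler_wpM2l.
have -> : 1 - x^-1 = (M - 1) * (t - t') / ((1 + t) * (M + t')).
  by rewrite /x; field; rewrite !gt_eqF //; lra.
have -> : M / ((1 + t) * (M + t)) * (t - t') =
   ((t - t') / (1 + t)) * (M / (M + t)) by field; rewrite !gt_eqF //; lra.
have -> : 2 * ((M - 1) * (t - t') / ((1 + t) * (M + t'))) =
   ((t - t') / (1 + t)) * (2 * (M - 1) / (M + t')).
  by field; rewrite !gt_eqF //; lra.
rewrite ler_wpM2l ?divr_ge0 ?subr_ge0 //; first by lra.
rewrite ler_pdivrMr; last by lra.
rewrite mulrAC ler_pdivlMr; last by lra.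
nra.
Qed.

End Damping.

(** * A nearly nonexpansive truncation *)

Section Truncation.
Context {R : realType} {X : normedModType R} (ip : X -> X -> R).
Context (ip_inner : inner_product ip) (e : nat ->
  X) (one : orthonormal_system ip e).
Implicit Types (x y : X) (m n N : nat) (om : R).

(** The total increase of [ln ((1 + t) / (4^m + t))] on the half-line is [m *
    ln 4]: linear in [m], against the factor [1 / m^2] in
    [damping_slope_sqr_le]. *)
Lemma sum_slope_kernel m (t : nat -> R) N : (0 < m)%N -> (forall n, 0 <= t n) ->
  (forall n, t n.+1 <= t n) ->
  \sum_(n < N) slope_kernel m (t n) * (t n - t n.+1) <= 8 * m%:R.
Proof.
move=> m0 t0 tS.
pose G u : R := ln ((1 + u) / (4 ^+ m + u)).
apply: (@le_trans _ _ (2 * (G (t 0%N) - G (t N)))).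
  elim: N => [|N IHN]; first by rewrite big_ord0 subrr mulr0.
  rewrite big_ord_recr /=; have :=
    @slope_kernel_step _ m (t N) (t N.+1) m0 (t0 _) (tS _).
  by rewrite -!/(G _); lra.
have M1 : 1 <= 4 ^+ m :> R by rewrite exprn_ege1 //; lra.
have G0 : G (t 0%N) <= 0.
  by apply: ln_le0; have := t0 0%N => h; rewrite ler_pdivrMr; lra.
have GN : - ln (4 ^+ m) <= G (t N).
  have h := t0 N.
  rewrite -lnV ?posrE; last by lra.
  rewrite ler_ln ?posrE ?divr_gt0 ?invr_gt0 //; try lra.
  rewrite ler_pdivlMr; last by lra.
  by rewrite mulrDr mulVf ?gt_eqF ?lerD2l ?ler_piMl // ?invf_le1; lra.
have L4 : ln (4 ^+ m) <= 4 * m%:R :> R.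
  rewrite lnXn // -[leLHS]mulr_natr ler_wpM2r //; apply/ltW.
  by apply: (@ln_sublinear R 4); lra.
lra.
Qed.

Definition tail_sqr_scaled om n x : R := (om * `|tail ip e n x|) ^+ 2.

(** The smoothing parameter decays with [n], so that the levels decay too from
    the index on at which the tails are small. *)
Definition level om n x : R := soft_excess (4^-1 ^+ n) (tail_sqr_scaled om n x).

Definition trunc_coef om m n x : R :=
    (1 - damping m (level om n x)) * ip x (e n).

Lemma quarter_gt0 n : 0 < 4^-1 ^+ n :> R. Proof. by rewrite exprn_gt0. Qed.

Lemma level_ge0 om n x : 0 <= level om n x.
Proof. exact: soft_excess_ge0 (quarter_gt0 _). Qed.

(** Measuring tails by [radius] instead of [level] turns the level into a
    Lipschitz function of the point. *)
Definition radius om n x : R := Num.sqrt (1 + level om n x).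

Lemma radius_sqr om n x : radius om n x ^+ 2 = 1 + level om n x.
Proof. by rewrite sqr_sqrtr // addr_ge0 ?level_ge0. Qed.

Lemma radius_ge1 om n x : 1 <= radius om n x.
Proof.
by rewrite -[leLHS]sqrtr1 ler_sqrt ?lerDl ?level_ge0 // addr_ge0 ?level_ge0.
Qed.

Lemma tail_sqr_scaled_le_radius om n x : tail_sqr_scaled om n x <=
    radius om n x ^+ 2.
Proof. by rewrite radius_sqr; have :=
  soft_excess_ge (tail_sqr_scaled om n x)
    (quarter_gt0 n); rewrite /level; lra. Qed.

(** The squares differ by at most the difference of the squares of the tail
    norms, and the radius dominates the tail norm. *)
Lemma radius_lipschitz om n x y : 0 < om -> radius om n x <= radius om n y ->
  radius om n y - radius om n x <= om * `|x - y|.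
Proof.
move=> om0 xy.
have sx := radius_ge1 om n x; have sy := radius_ge1 om n y.
pose p := om * `|tail ip e n x|; pose q := om * `|tail ip e n y|.
have p0 : 0 <= p by rewrite mulr_ge0 // ltW.
have q0 : 0 <= q by rewrite mulr_ge0 // ltW.
have qp : q - p <= om * `|x - y|.
  rewrite -mulrBr ler_wpM2l ?(ltW om0) //.
  apply: le_trans (lerB_dist _ _) _.
  by rewrite -(tailB ip_inner) [leRHS]distrC; exact: (tail_le ip_inner one).
have [qlp|plq] := leP q p.
  have : radius om n y <= radius om n x.
    rewrite ler_sqrt ?addr_ge0 ?level_ge0 // lerD2l.
    have tt : tail_sqr_scaled om n y <=
      tail_sqr_scaled om n x by rewrite lerXn2r ?nnegrE.
    by have /andP[+ _] := soft_excess_lipschitz (quarter_gt0 n) tt;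
      rewrite subr_ge0.
  by move=> yx; rewrite (le_trans (_ : _ <= 0)) ?subr_le0 // mulr_ge0 // ltW.
apply: le_trans qp.
have tt : tail_sqr_scaled om n x <=
  tail_sqr_scaled om n y by rewrite lerXn2r ?nnegrE // ltW.
have /andP[_ H] := soft_excess_lipschitz (quarter_gt0 n) tt.
have H2 : radius om n y ^+ 2 - radius om n x ^+ 2 <= q ^+ 2 - p ^+ 2.
  by rewrite !radius_sqr; move: H; rewrite /level /tail_sqr_scaled -/p -/q; lra.
have qs : q <= radius om n y.
  by rewrite -(@ler_pXn2r _ 2) ?nnegrE ?tail_sqr_scaled_le_radius //; lra.
have ps : p <= radius om n x.
  by rewrite -(@ler_pXn2r _ 2) ?nnegrE ?tail_sqr_scaled_le_radius //; lra.
move: H2; rewrite !subr_sqr => H2.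
have S0 : 0 < radius om n y + radius om n x by lra.
rewrite -(ler_pM2r S0); apply: le_trans H2 _.
by rewrite ler_wpM2l //; lra.
Qed.

(** The Lipschitz constant of the damping factor, times the coordinate that it
    multiplies. *)
Definition drift om m n x : R := om * (damping_slope m
    (radius om n x) * `|ip x (e n)|).

(** The squared coordinates are the differences of the squared tail norms, so
    the sum is a Riemann sum for [slope_kernel] over the decreasing sequence
    of these. *)
Lemma sum_drift om m x N : 0 < om -> (0 < m)%N ->
  \sum_(n < N) drift om m n x ^+ 2 <= 2048 / m%:R.
Proof.
move=> om0 m0; pose t n := tail_sqr_scaled om n x.
have t0 n : 0 <= t n by rewrite sqr_ge0.
have tE n : t n - t n.+1 = om ^+ 2 * ip x (e n) ^+ 2.
  by rewrite /t /tail_sqr_scaled !exprMn (tail_sqr ip_inner one); ring.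
have tS n : t n.+1 <= t n by rewrite -subr_ge0 tE mulr_ge0 ?sqr_ge0.
apply: (@le_trans _ _ (256 / m%:R ^+ 2 * \sum_(n < N) slope_kernel m (t n) *
  (t n - t n.+1))).
  rewrite mulr_sumr; apply: ler_sum => n _; rewrite tE.
  have -> : drift om m n x ^+ 2 =
      damping_slope m (radius om n x) ^+ 2 * (om ^+ 2 * ip x (e n) ^+ 2).
    by rewrite /drift !exprMn real_normK ?num_real //; ring.
  rewrite [leRHS]mulrA; apply: ler_wpM2r; first by rewrite mulr_ge0 ?sqr_ge0.
  exact: damping_slope_sqr_le m0 (radius_ge1 _ _ _) (t0 _)
    (tail_sqr_scaled_le_radius _ _ _).
have mR : 0 < m%:R :> R by rewrite ltr0n.
apply: (@le_trans _ _ (256 / m%:R ^+ 2 * (8 * m%:R))).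
  by rewrite ler_wpM2l ?divr_ge0 ?sqr_ge0 ?sum_slope_kernel.
by rewrite le_eqVlt; apply/orP; left; apply/eqP; field; rewrite gt_eqF.
Qed.

Lemma drift_ge0 om m n x : 0 < om -> 0 <= drift om m n x.
Proof.
move=> om0; rewrite mulr_ge0 ?(ltW om0) // mulr_ge0 // /damping_slope.
have h := radius_ge1 om n x.
rewrite mulr_ge0 ?divr_ge0 ?mulr_ge0 ?exprn_ge0 //; first by lra.
by rewrite addr_ge0 ?exprn_ge0 //; lra.
Qed.

(** Of the two points let [x] be the one with the smaller radius, and split
    the difference so that the variation of the damping multiplies the
    coordinate of [x]: the slope bound of [damping_lipschitz] holds at the
    smaller radius. *)
Lemma trunc_coef_dist om m n x y : 0 < om -> (0 < m)%N ->
  `|trunc_coef om m n x - trunc_coef om m n y| <=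
  `|ip (x - y) (e n)| + `|x - y| * (drift om m n x + drift om m n y).
Proof.
move=> om0 m0.
wlog xy : x y / radius om n x <= radius om n y.
  move=> W; have [xy|/ltW yx] := leP (radius om n x)
    (radius om n y); first exact: W.
  have := W y x yx; rewrite distrC -[y - x]opprB normrN (ipNl ip_inner) normrN.
  by rewrite [drift _ _ _ y + _]addrC.
have lE z : damping m (level om n z) = damping m (radius om n z ^+ 2 - 1).
  by rewrite radius_sqr addrC addKr.
have /andP[H1 H2] := damping_lipschitz m0 (radius_ge1 om n x) xy.
rewrite -!lE in H1 H2.
set a := damping m (level om n x) in H1 H2 *.
set b := damping m (level om n y) in H1 H2 *.
have b0 : 0 <= b by exact/damping_ge0/level_ge0.
have b1 : b <= 1 by exact/damping_le1/level_ge0.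
have -> : trunc_coef om m n x - trunc_coef om m n y =
    (1 - b) * ip (x - y) (e n) - (a - b) * ip x (e n).
  by rewrite /trunc_coef -/a -/b (ipBl ip_inner); ring.
apply: le_trans (ler_normB _ _) _; apply: lerD.
  by rewrite normrM ger0_norm ?subr_ge0 // ler_piMl // gerBl.
rewrite normrM (ger0_norm H1).
apply: (@le_trans _ _ (`|x - y| * drift om m n x)); last first.
  by rewrite ler_wpM2l // lerDl drift_ge0.
have -> : `|x - y| * drift om m n x =
   damping_slope m (radius om n x) * (om * `|x - y|) * `|ip x (e n)|.
  by rewrite /drift; ring.
rewrite ler_wpM2r //; apply: le_trans H2 _.
rewrite ler_wpM2l ?radius_lipschitz // /damping_slope.
have h := radius_ge1 om n x.
rewrite mulr_ge0 ?divr_ge0 ?mulr_ge0 ?exprn_ge0 //; first by lra.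
by rewrite addr_ge0 ?exprn_ge0 //; lra.
Qed.

(** The main terms of [trunc_coef_dist] sum to at most [|x - y|^2] by Bessel's
    inequality, and the drifts to [O(1/m) * |x - y|^2]; the two are combined
    by [(V + W)^2 <= (1 + eps) V^2 + (1 + 1/eps) W^2]. *)
Lemma truncation_lipschitz (eps : R) : 0 < eps -> exists2 m, (0 < m)%N &
  forall om N x y, 0 < om ->
  `|\sum_(n < N) (trunc_coef om m n x - trunc_coef om m n y) *: e n| <=
    (1 + eps) * `|x - y|.
Proof.
move=> eps0.
pose b : R := (1 + eps^-1) * 8192 / eps.
have [m mb] : exists m : nat, b <= m.+1%:R.
  by exists (Num.truncn b); exact/ltW/truncnS_gt.
exists m.+1 => // om N x y om0.
have E : \sum_(n < N) (trunc_coef om m.+1 n x - trunc_coef om m.+1 n y) ^+ 2 <=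
    ((1 + eps) * `|x - y|) ^+ 2.
  pose D n := drift om m.+1 n x ^+ 2 + drift om m.+1 n y ^+ 2.
  apply: (@le_trans _ _ (\sum_(n < N) ((1 + eps) * ip (x - y) (e n) ^+ 2 +
     (1 + eps^-1) * 2 * `|x - y| ^+ 2 * D n))).
    apply: ler_sum => n _.
    have := @trunc_coef_dist om m.+1 n x y om0 isT.
    set u := trunc_coef _ _ _ _ - _; set v := ip (x - y) (e n).
    have dx := drift_ge0 m.+1 n x om0; have dy := drift_ge0 m.+1 n y om0.
    rewrite /D; move: dx dy; set p := drift _ _ _ x; set q := drift _ _ _ y =>
      dx dy H.
    have -> : u ^+ 2 = `|u| ^+ 2 by rewrite real_normK ?num_real.
    have -> : v ^+ 2 = `|v| ^+ 2 by rewrite real_normK ?num_real.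
    apply: (@le_trans _ _ ((`|v| + `|x - y| * (p + q)) ^+ 2)).
      by rewrite lerXn2r ?nnegrE // addr_ge0 // mulr_ge0 // addr_ge0.
    move: (`|v|) (`|x - y|) => V d.
    have h1 : (V + d * (p + q)) ^+ 2 = (1 + eps) * V ^+ 2 +
      (1 + eps^-1) * (d * (p + q)) ^+ 2 - eps^-1 * (eps * V - d * (p + q)) ^+ 2.
      by field; rewrite gt_eqF.
    have h2 : (1 + eps^-1) * (d * (p + q)) ^+ 2 =
      (1 + eps^-1) * 2 * d ^+ 2 * (p ^+ 2 + q ^+ 2)
       - (1 + eps^-1) * d ^+ 2 * (p - q) ^+ 2 by ring.
    have h3 : 0 <= eps^-1 * (eps * V - d * (p + q)) ^+ 2.
      by rewrite mulr_ge0 ?sqr_ge0 // invr_ge0 ltW.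
    have h4 : 0 <= (1 + eps^-1) * d ^+ 2 * (p - q) ^+ 2.
      by rewrite mulr_ge0 ?sqr_ge0 // mulr_ge0 ?sqr_ge0 // addr_ge0 // invr_ge0
        ltW.
    by lra.
  rewrite big_split /= -!mulr_sumr big_split /=.
  have B := bessel ip_inner one N (x - y).
  have Dx := @sum_drift om m.+1 x N om0 isT; have Dy :=
    @sum_drift om m.+1 y N om0 isT.
  have c0 : 0 <= (1 + eps^-1) * 2 * `|x - y| ^+ 2.
    by rewrite !mulr_ge0 ?sqr_ge0 // addr_ge0 // invr_ge0 ltW.
  apply: (@le_trans _ _ ((1 + eps) * `|x - y| ^+ 2 +
     (1 + eps^-1) * 2 * `|x - y| ^+ 2 * (4096 / m.+1%:R))).
    apply: lerD; first by rewrite ler_wpM2l // addr_ge0 // ltW.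
    rewrite ler_wpM2l //; apply: le_trans (lerD Dx Dy) _.
    by rewrite -mulrDl -natrD.
  have mb' : (1 + eps^-1) * 8192 / m.+1%:R <= eps.
    rewrite ler_pdivrMr ?ltr0n // -ler_pdivrMl //.
    by rewrite mulrC.
  rewrite exprMn; set d := `|x - y| ^+ 2.
  have d0 : 0 <= d by rewrite sqr_ge0.
  have -> : (1 + eps^-1) * 2 * d * (4096 / m.+1%:R) =
    (1 + eps^-1) * 8192 / m.+1%:R * d.
    by ring.
  rewrite -mulrDl ler_wpM2r //; apply: le_trans (lerD (lexx _) mb') _.
  by have := sqr_ge0 eps; lra.
rewrite -(@ler_pXn2r _ 2) ?nnegrE //;
  last by rewrite mulr_ge0 // addr_ge0 // ltW.
apply: le_trans E.
exact: (norm_combination ip_inner one N (fun n =>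
  trunc_coef om m.+1 n x - trunc_coef om m.+1 n y)).
Qed.

(** Up to the tail, the difference has the coordinates [x_n] times dampings of
    at most [2 * 4^m / (4^m + t_n)], with [t_n] the scaled squared tails, and
    [(4^m / (4^m + t))^2] has a finite integral, at most [4^m]. *)
Lemma truncation_displacement om m N x : 0 < om -> (0 < m)%N ->
  `|x - \sum_(n < N) trunc_coef om m n x *: e n| <=
    `|tail ip e N x| + 2 * 2 ^+ m / om.
Proof.
move=> om0 m0.
have -> : x - \sum_(n < N) trunc_coef om m n x *: e n =
   tail ip e N x + \sum_(n < N) (ip x (e n) - trunc_coef om m n x) *: e n.
  under [X in _ = _ + X]eq_bigr do rewrite scalerBl.
  by rewrite sumrB /tail addrA subrK.
apply: le_trans (ler_normD _ _) _; rewrite lerD2l.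
have M0 : 0 < 4 ^+ m :> R by rewrite exprn_gt0.
have M4 : 4 <= 4 ^+ m :> R by rewrite -[leLHS]expr1 ler_eXn2l ?ltr1n.
rewrite -(@ler_pXn2r _ 2) ?nnegrE //;
  last by rewrite divr_ge0 ?mulr_ge0 ?exprn_ge0 // ltW.
apply: le_trans (norm_combination ip_inner one N (fun n =>
  ip x (e n) - trunc_coef om m n x)) _.
pose t n := tail_sqr_scaled om n x.
have t0 n : 0 <= t n by rewrite sqr_ge0.
have tE n : t n - t n.+1 = om ^+ 2 * ip x (e n) ^+ 2.
  by rewrite /t /tail_sqr_scaled !exprMn (tail_sqr ip_inner one); ring.
have tS n : t n.+1 <= t n by rewrite -subr_ge0 tE mulr_ge0 ?sqr_ge0.
pose G u : R := 4 * (4 ^+ m * (4 ^+ m / (4 ^+ m + u))).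
apply: (@le_trans _ _ ((om ^+ 2)^-1 * (G (t N) - G (t 0%N)))).
  elim: N => [|N IHN]; first by rewrite big_ord0 subrr mulr0.
  rewrite big_ord_recr /=.
  suff H : (ip x (e N) - trunc_coef om m N x) ^+ 2 <=
    (om ^+ 2)^-1 * (G (t N.+1) - G (t N)).
    by move: IHN H; set a := (om ^+ 2)^-1; lra.
  rewrite ler_pdivlMl ?exprn_gt0 //.
  have -> : om ^+ 2 * (ip x (e N) - trunc_coef om m N x) ^+ 2 =
      damping m (level om N x) ^+ 2 * (t N - t N.+1).
    by rewrite tE /trunc_coef; ring.
  have L0 := damping_ge0 m (level_ge0 om N x).
  have L1 := damping_decay m0 (level_ge0 om N x).
  have lev : t N - 1 <= level om N x by exact: soft_excess_ge (quarter_gt0 N).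
  have lev0 := level_ge0 om N x.
  have L2 : damping m (level om N x) <= 2 * 4 ^+ m / (4 ^+ m + t N).
    apply: le_trans L1 _; rewrite ler_pdivrMr; last by lra.
    rewrite mulrAC ler_pdivlMr; last by have := t0 N; lra.
    nra.
  have h1 := t0 N; have h2 := t0 N.+1; have h3 := tS N.
  have -> : G (t N.+1) - G (t N) =
    (2 * 4 ^+ m / (4 ^+ m + t N)) * (2 * 4 ^+ m / (4 ^+ m +
      t N.+1)) * (t N - t N.+1).
    by rewrite /G; field; rewrite !gt_eqF //; lra.
  rewrite ler_wpM2r ?subr_ge0 // expr2; apply: ler_pM => //.
  apply: le_trans L2 _; rewrite ler_wpM2l ?mulr_ge0 ?(ltW M0) //.
  by rewrite lef_pV2 ?posrE; lra.
rewrite exprMn exprVn mulrC ler_wpM2r ?invr_ge0 ?sqr_ge0 // exprMn -four_exp.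
have G0 : 0 <= G (t 0%N).
  by rewrite /G !mulr_ge0 ?invr_ge0 ?addr_ge0 // ltW.
have GN : G (t N) <= 4 * 4 ^+ m.
  rewrite /G ler_wpM2l // ler_piMr ?(ltW M0) // ler_pdivrMr ?mul1r ?lerDl //.
  by have := t0 N; lra.
rewrite expr2; lra.
Qed.

End Truncation.

(** * The truncated coefficients are analytic, uniformly in their index *)

Section DampingAnalytic.
Context {R : realType} {X : normedModType R}.
Implicit Types (t u z : X -> R).

Lemma analytic_le_sum r M m (u_ : nat -> X -> R) : 0 < r ->
  (forall k, analytic_le r M (u_ k)) ->
    analytic_le r (m%:R * M) (fun h => \sum_(k < m) u_ k h).
Proof.
move=> r0 Hu; elim: m => [|m IHm].
  rewrite mul0r; apply: analytic_le_ext (analytic_le0 r0) =>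
    // h _; by rewrite big_ord0.
rewrite -natr1 mulrDl mul1r; apply: analytic_le_ext (analytic_leD IHm
  (Hu m)) => // h _.
by rewrite big_ord_recr.
Qed.

(** The function [soft_excess d] solves a quadratic equation. Around [t0],
    with [S] the square root in its definition and [y0] its value, the
    increment [z] solves [z = t * y0 / S + (t / S) * z - z^2 / S]. The norm of
    [z] is bounded by a multiple of [y0], which is what makes the coefficients
    small and not only analytic. *)
Lemma analytic_le_soft_excess r (d t0 T : R) t : 0 < r -> 0 < d ->
    analytic_le r T t ->
  16 * T <= Num.sqrt ((t0 - 1) ^+ 2 + d) ->
  analytic_le r (soft_excess d t0 / 8) (fun h =>
    soft_excess d (t0 + t h) - soft_excess d t0).
Proof.
move=> r0 d0 At; have T0 := analytic_le_ge0 At.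
have [S [S0 S2 y0E]] := soft_excess_sqrt t0 d0.
have -> : Num.sqrt ((t0 - 1) ^+ 2 + d) = S by rewrite -S2 sqrtr_sqr gtr0_norm.
move=> TS; set y0 := soft_excess d t0 in y0E *.
have y00 : 0 <= y0 by exact: soft_excess_ge0.
have y0S : y0 <= S.
  rewrite y0E ler_pdivrMr //; nra.
have TS' : T / S <= 16^-1 by rewrite ler_pdivrMr //; lra.
have Sn : `|- S^-1| = S^-1 by rewrite normrN ger0_norm // invr_ge0 ltW.
pose a h := y0 / S * t h; pose b h := S^-1 * t h.
have Aa : analytic_le r (y0 / S * T) a.
  by have := analytic_leZ (y0 / S) At; rewrite ger0_norm // divr_ge0 // ltW.
have Ab : analytic_le r 4^-1 b.
  apply: analytic_le_weaken (analytic_leZ S^-1 At) =>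
    //; rewrite ger0_norm ?invr_ge0 ?(ltW S0) //.
  by rewrite mulrC; apply: le_trans TS' _; lra.
have Teq : y0 / S * T = y0 * (T / S) by ring.
apply: analytic_le_weaken (analytic_le_quadratic (c :=
  - S^-1) r0 Aa Ab _ _ _) => //.
- by rewrite Teq; have := ler_wpM2l y00 TS'; lra.
- rewrite Sn.
  have -> : S^-1 * (y0 / S * T) = (y0 / S) * (T / S) by field; rewrite gt_eqF.
  rewrite -[leRHS]mul1r; apply: ler_pM => //.
  + by rewrite divr_ge0 // ltW.
  + by rewrite divr_ge0 // ltW.
  + by rewrite ler_pdivrMr // mul1r.
- move=> h hr; rewrite /a /b.
  have [S' [S'0 S'2 ->]] := soft_excess_sqrt (t0 + t h) d0; rewrite y0E.
  have -> : (t0 + t h - 1 + S') / 2 - (t0 - 1 + S) / 2 =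
    (t h + S' - S) / 2 by field.
  have e : S' ^+ 2 - S ^+ 2 = t h * (2 * (t0 - 1) +
    t h) by rewrite S2 S'2; ring.
  apply/eqP; rewrite -subr_eq0; apply/eqP.
  transitivity ((S' ^+ 2 - S ^+ 2 - t h * (2 * (t0 - 1) + t h)) / (4 * S)).
    by field; rewrite gt_eqF.
  by rewrite e subrr mul0r.
- move=> h hr; rewrite normrM Sn ler_pdivrMl //.
  apply: (@le_trans _ _ `|t h|);
    last by apply: le_trans (analytic_le_norm r0 At hr) _; lra.
  have [th|th] := leP 0 (t h).
    have tt : t0 <= t0 + t h by rewrite lerDl.
    have /andP[H1 H2] := soft_excess_lipschitz d0 tt.
    by rewrite !ger0_norm //; move: H2; rewrite -/y0; lra.
  have tt : t0 + t h <= t0 by rewrite gerDl ltW.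
  have /andP[H1 H2] := soft_excess_lipschitz d0 tt.
  by rewrite distrC (ltr0_norm th) ger0_norm //; move: H2; rewrite -/y0; lra.
Qed.

(** The increment [v] of [4^k / (4^k + u)] solves the linear equation [v = - q
    u / p^2 - (u / p) v] with [q = 4^k] and [p = q + y0]. *)
Lemma analytic_le_damping r m y0 u : (0 < m)%N -> 0 < r -> 0 <= y0 ->
    (forall h, 0 <= y0 + u h) ->
  analytic_le r (y0 / 8) u -> analytic_le r (y0 / 4) (fun h =>
    damping m (y0 + u h) - damping m y0).
Proof.
move=> m0 r0 y00 yu Au.
pose v (k : nat) h : R := 4 ^+ k / (4 ^+ k + (y0 + u h)) - 4 ^+ k / (4 ^+ k +
  y0).
have Av k : analytic_le r (y0 / 4) (v k).
  have q1 : 1 <= 4 ^+ k :> R by rewrite exprn_ege1 //; lra.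
  move: q1; rewrite /v; set q : R := 4 ^+ k => q1.
  have p0 : 0 < q + y0 by lra.
  pose a h := - q / (q + y0) ^+ 2 * u h; pose b h := - (q + y0)^-1 * u h.
  have Aa : analytic_le r (y0 / 8) a.
    apply: analytic_le_weaken (analytic_leZ _ Au) => //.
    rewrite ler_piMl ?divr_ge0 // mulNr normrN ger0_norm; last first.
      by rewrite divr_ge0 ?sqr_ge0 //; lra.
    by rewrite ler_pdivrMr ?exprn_gt0 // mul1r; nra.
  have Ab : analytic_le r 4^-1 b.
    apply: analytic_le_weaken (analytic_leZ _ Au) =>
      //; rewrite normrN ger0_norm ?invr_ge0 ?(ltW p0) //.
    by rewrite ler_pdivrMl //; lra.
  apply: analytic_le_weaken (analytic_le_quadratic (c := 0) r0 Aa Ab _ _ _) =>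
    //.
  - by lra.
  - by rewrite normr0 mul0r.
  - move=> h _; have := yu h => yh; rewrite /a /b mul0r addr0; field.
    by rewrite !gt_eqF //; lra.
  - by move=> h _; rewrite mul0r normr0.
have := analytic_leZ m%:R^-1 (analytic_le_sum m r0 Av).
rewrite ger0_norm ?invr_ge0 // mulrA mulVf ?mul1r;
  last by rewrite pnatr_eq0 -lt0n.
apply: analytic_le_ext => // h _.
by rewrite /damping -mulrBr -sumrB.
Qed.

End DampingAnalytic.

Section CoefAnalytic.
Context {R : realType} {X : normedModType R} (ip : X -> X -> R).
Context (ip_inner : inner_product ip) (e : nat -> X)
  (one : orthonormal_system ip e)
  (total : forall x, `|tail ip e n x| @[n --> \oo] --> 0).
Implicit Types (x y h : X) (m n : nat).

Lemma tail_linear n (a : R) x y : tail ip e n (a *: x + y) =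
    a *: tail ip e n x + tail ip e n y.
Proof.
elim: n => [|n IHn]; first by rewrite !tail0.
rewrite !tailS IHn (ipPl ip_inner); move: (tail ip e n x) (tail ip e n y) =>
  p q.
by rewrite scalerDl scalerBr scalerA opprD addrACA.
Qed.

Lemma orthonormal_norm_le1 n : `|e n| <= 1.
Proof. by case: one => _ /(_ n) [->|->]; rewrite ?normr0. Qed.

Lemma analytic_le_tail_sqr om n x r : 0 < r -> r <= 1 ->
    analytic_le r (om ^+ 2 * (64 * `|x| + 72) * r)
  (fun h => tail_sqr_scaled ip e om n (x + h) - tail_sqr_scaled ip e om n x).
Proof.
move=> r0 r1; pose Q := tail ip e n.
have ip0 := cauchy_schwarz ip_inner; have Qle := tail_le ip_inner one n.
have E h : tail_sqr_scaled ip e om n (x + h) - tail_sqr_scaled ip e om n x =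
    om ^+ 2 * (2 * ip (Q h) (Q x) + ip (Q h) (Q h)).
  have QD : Q (x + h) = Q x + Q h by have :=
    tail_linear n 1 x h; rewrite !scale1r.
  rewrite /tail_sqr_scaled !exprMn -/Q -!(ip_norm ip_inner) QD; move: (Q x)
    (Q h) => p q.
  by rewrite (ipDl ip_inner) !(ipDr ip_inner) (ipC ip_inner p q); ring.
have L1 : analytic_le r (32 * `|x| * r) (fun h => ip (Q h) (Q x)).
  apply: analytic_le_linear => //.
    by move=> a u v; rewrite /Q tail_linear (ipPl ip_inner).
  move=> h; apply: le_trans (ip0 _ _) _; rewrite mulrC.
  by rewrite ler_pM.
have L2 : analytic_le r (72 * 1 * r ^+ 2) (fun h => ip (Q h) (Q h)).
  apply: (@analytic_le_bilinear _ _ _ (fun h k => ip (Q h) (Q k))) => //.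
  - by move=> y a u v; rewrite /Q tail_linear (ipPl ip_inner).
  - by move=> y a u v; rewrite /Q tail_linear (ipPr ip_inner).
  - move=> y z; rewrite mul1r; apply: le_trans (ip0 _ _) _.
    by rewrite ler_pM.
have H := analytic_le_ext r0 (fun h _ =>
  esym (E h)) (analytic_leZ (om ^+ 2) (analytic_leD (analytic_leZ 2 L1) L2)).
apply: analytic_le_weaken H => //.
rewrite (ger0_norm (sqr_ge0 om)) -[leRHS]mulrA ler_wpM2l ?sqr_ge0 // ger0_norm
  //.
have : r ^+ 2 <= r by rewrite expr2 ler_piMl // ltW.
by lra.
Qed.

(** Beyond some index the scaled tails at [x] are at most [1/4]: there the
    square root is at least [3/4] and the level at most [4^-n]. The finitely
    many other indices are absorbed in the constants. *)
Lemma level_bounds om x : 0 < om -> exists s0 K, [/\ 0 < s0, s0 <= 1, 0 <= K &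
  forall n, s0 <= Num.sqrt ((tail_sqr_scaled ip e om n x - 1) ^+ 2 +
    4^-1 ^+ n) /\
    level ip e om n x <= K * 4^-1 ^+ n].
Proof.
move=> om0.
have [N HN] : exists N, forall n, (N <= n)%N ->
  tail_sqr_scaled ip e om n x <= 4^-1.
  have o2 : 0 < (2 * om)^-1 by rewrite invr_gt0 mulr_gt0.
  have /cvgrPdist_le/(_ _ o2) [N _ HN] := total x.
  exists N => n /HN /=; rewrite sub0r normrN normr_id => H.
  have h1 : om * `|tail ip e n x| <= 2^-1.
    rewrite -ler_pdivlMl //; apply: le_trans H _.
    by rewrite invfM mulrC.
  have -> : 4^-1 = 2^-1 ^+ 2 :> R by rewrite expr2 -invfM -natrM.
  by rewrite lerXn2r ?nnegrE ?mulr_ge0 // ltW.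
pose B := (om * `|x|) ^+ 2 + 2.
have B0 : 0 <= B by rewrite addr_ge0 ?sqr_ge0.
have p4 : 1 <= 4 ^+ N :> R by rewrite exprn_ege1 //; lra.
have h2 : 0 < 2^-1 ^+ N :> R by rewrite exprn_gt0.
have h21 : 2^-1 ^+ N <= 1 :> R by rewrite exprn_ile1 //; lra.
exists (2^-1 * 2^-1 ^+ N), (B * 4 ^+ N); split.
- by rewrite mulr_gt0.
- by lra.
- by rewrite mulr_ge0 //; lra.
move=> n; have d0 := quarter_gt0 (R := R) n.
have d1 : 4^-1 ^+ n <= 1 :> R by rewrite exprn_ile1 //; lra.
have tau0 : 0 <= tail_sqr_scaled ip e om n x by rewrite sqr_ge0.
have tauB : tail_sqr_scaled ip e om n x <= (om * `|x|) ^+ 2.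
  rewrite lerXn2r ?nnegrE ?mulr_ge0 ?(ltW om0) // ler_wpM2l ?(ltW om0) //.
  exact: (tail_le ip_inner one).
rewrite /level; have [S [S0 S2 ->]] :=
  soft_excess_sqrt (tail_sqr_scaled ip e om n x) d0.
have -> : Num.sqrt ((tail_sqr_scaled ip e om n x - 1) ^+ 2 + 4^-1 ^+ n) = S.
  by rewrite -S2 sqrtr_sqr gtr0_norm.
move: d0 d1 tau0 tauB S2 (HN n); set d : R := 4^-1 ^+ n; set t :=
  tail_sqr_scaled _ _ _ _ _.
move=> d0 d1 t0 tB S2 Ht.
have [Nn|nN] := leqP N n.
  have t4 := Ht Nn; have S34 : 3 / 4 <= S by nra.
  split; first by lra.
  have : (t - 1 + S) / 2 <= d by rewrite ler_pdivrMr //; nra.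
  move=> H; apply: le_trans H _.
  rewrite ler_peMl ?(ltW d0) //; rewrite /B; have := sqr_ge0 (om * `|x|).
  by nra.
have dN : 2^-1 ^+ N * 2^-1 ^+ N <= d.
  rewrite /d -expr2 -exprM mulnC exprM.
  have -> : 2^-1 ^+ 2 = 4^-1 :> R by rewrite expr2 -invfM -natrM.
  by apply: ler_wiXn2l; [lra|lra|exact: ltnW].
split.
  have : 2^-1 ^+ N * 2^-1 ^+ N <= S ^+ 2 by rewrite S2; have :=
    sqr_ge0 (t - 1); lra.
  by nra.
have dN1 : 1 <= 4 ^+ N * d.
  have E1 : 4 ^+ N * 4^-1 ^+ N = 1 :> R by rewrite -exprMn mulfV ?expr1n //;
    lra.
  rewrite -[leLHS]E1; apply: ler_wpM2l; first by lra.
  by apply: ler_wiXn2l; [lra|lra|exact: ltnW].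
have SB : (t - 1 + S) / 2 <= B by rewrite ler_pdivrMr // /B; nra.
rewrite -mulrA; apply: le_trans SB _; rewrite ler_peMr //.
Qed.

(** The radius does not depend on [n], since by [level_bounds] the square
    roots in the levels are bounded below uniformly in [n]. *)
Lemma analytic_le_trunc_coef om m x : 0 < om -> (0 < m)%N ->
    exists r K, [/\ 0 < r, 0 <= K &
  forall n, analytic_le r (K * 4^-1 ^+ n)
      (fun h => trunc_coef ip e om m n (x + h) - trunc_coef ip e om m n x) /\
    `|trunc_coef ip e om m n x| <= K * 4^-1 ^+ n].
Proof.
move=> om0 m0; have [s0 [K0 [s00 s01 K00 Hlev]]] := level_bounds x om0.
pose T := om ^+ 2 * (64 * `|x| + 72).
have T0 : 0 <= T by rewrite mulr_ge0 ?sqr_ge0 // addr_ge0 // mulr_ge0.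
pose r := s0 / (16 * (T + 1)).
have r0 : 0 < r by rewrite divr_gt0 // mulr_gt0 //; lra.
have r1 : r <= 1 by rewrite /r ler_pdivrMr ?mulr_gt0 //; lra.
have rT : 16 * (T * r) <= s0.
  have rE : r * (16 * (T + 1)) = s0.
    by rewrite /r divfK // gt_eqF // mulr_gt0 //; lra.
  by move: rE r0; move: (r) => r' rE r0; nra.
exists r, (K0 * (40 + 2 * `|x|)); split=> //.
  by rewrite mulr_ge0 // addr_ge0 // mulr_ge0.
move=> n; have [sS lev] := Hlev n.
set y0 := level ip e om n x in lev.
have y00 : 0 <= y0 by exact: level_ge0.
have xn : `|ip x (e n)| <= `|x|.
  apply: le_trans (cauchy_schwarz ip_inner _ _) _.
  by rewrite ler_piMr ?orthonormal_norm_le1.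
have yb : y0 * (40 + 2 * `|x|) <= K0 * (40 + 2 * `|x|) * 4^-1 ^+ n.
  by rewrite [leRHS]mulrAC ler_wpM2r // addr_ge0 // mulr_ge0.
have L1 : 1 - damping m y0 <= y0 by exact: damping_compl_le.
have L0 : 0 <= 1 - damping m y0 by rewrite subr_ge0 damping_le1.
have At := analytic_le_tail_sqr om n x r0 r1.
pose z h := level ip e om n (x + h) - y0.
have Az : analytic_le r (y0 / 8) z.
  have := analytic_le_soft_excess (t0 :=
    tail_sqr_scaled ip e om n x) r0 (quarter_gt0 n) At (le_trans rT sS).
  by apply: analytic_le_ext => // h _; rewrite subrKC.
have Aw : analytic_le r (y0 / 4) (fun h =>
  damping m (level ip e om n (x + h)) - damping m y0).
  have zE h : y0 + z h = level ip e om n (x + h) by rewrite /z subrKC.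
  have := analytic_le_damping m0 r0 y00 _ Az; move=> H.
  apply: analytic_le_ext (H _) => // [h _|h]; rewrite zE //; exact: level_ge0.
have Al : analytic_le r (32 * 1 * r) (ip^~ (e n)).
  apply: analytic_le_linear => //; first exact: ipPl.
  move=> h; apply: le_trans (cauchy_schwarz ip_inner _ _) _.
  by rewrite mulrC ler_wpM2r ?orthonormal_norm_le1.
have Ac := analytic_le_cst (X := X) (ip x (e n)) r0.
split; last first.
  rewrite /trunc_coef -/y0 normrM ger0_norm //.
  by apply: le_trans yb; apply: ler_pM => //; have := normr_ge0 x; lra.
have := analytic_leD (analytic_leZ (1 - damping m y0) Al) (analytic_leZ (-1)
  (analytic_leM r0 Aw (analytic_leD Ac Al))).
move=> H; apply: analytic_le_weaken (analytic_le_ext r0 _ H) => //.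
  apply: le_trans yb; rewrite normrN1 mul1r (ger0_norm L0).
  have h1 : (1 - damping m y0) * (32 * 1 * r) <= y0 * 32.
    by apply: ler_pM => //; lra.
  have h2 : y0 / 4 * (8 * `|ip x (e n)| + 32 * 1 * r) <=
    y0 / 4 * (8 * `|x| + 32).
    apply: ler_wpM2l; first by rewrite divr_ge0.
    by apply: lerD; [rewrite ler_wpM2l|lra].
  by lra.
move=> h _ /=; rewrite /trunc_coef -/y0 (ipDl ip_inner); ring.
Qed.

End CoefAnalytic.

(** * Gaussian smoothing along the orthonormal system *)

Section Smoothing.
Context {R : realType} {X : normedModType R} (e : nat -> X) (sg : nat -> R).
Context (e_le1 : forall n, `|e n| <= 1) (sg_gt0 : forall n, 0 < sg n).
Implicit Types (F G : X -> R) (x y h : X) (L : R) (a : nat -> R).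

Definition lip_le L F := 0 <= L /\ forall x y, `|F x - F y| <= L * `|x - y|.

Lemma lip_leD L L' F G : lip_le L F -> lip_le L' G ->
    lip_le (L + L') (fun y => F y + G y).
Proof.
move=> [L0 HF] [L'0 HG]; split; first exact: addr_ge0.
move=> x y; rewrite opprD addrACA mulrDl.
by apply: le_trans (ler_normD _ _) _; exact: lerD.
Qed.

Lemma lip_leZ c L F : lip_le L F -> lip_le (`|c| * L) (fun y => c * F y).
Proof.
move=> [L0 HF]; split; first exact: mulr_ge0.
by move=> x y; rewrite -mulrBr normrM -mulrA; exact: ler_wpM2l.
Qed.

Lemma lip_le0 : lip_le 0 (fun=> 0).
Proof. by split=> // x y; rewrite subrr normr0 mul0r. Qed.

Lemma lip_le_shift L F v : lip_le L F -> lip_le L (fun y => F (y + v)).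
Proof. by move=> [L0 HF]; split=> // x y; apply: le_trans (HF _ _) _;
  rewrite opprD addrACA subrr addr0. Qed.

Lemma tame_line L F y c n : lip_le L F ->
    tame (fun t => F (y + (c + sg n * t) *: e n)).
Proof.
move=> [L0 HF]; apply: (@tame_lipschitz _ _ (L * sg n)) => s t.
apply: le_trans (HF _ _) _; rewrite -mulrA ler_wpM2l //.
rewrite opprD addrACA subrr add0r -scalerBl opprD addrACA subrr add0r -mulrBr.
rewrite normrZ normrM (gtr0_norm (sg_gt0 n)) -[leRHS]mulr1.
by rewrite ler_wpM2l // mulr_ge0 // ltW.
Qed.

Definition smear n c F y := gauss_mean (fun t => F (y + (c + sg n * t) *: e n)).

Lemma gauss_mean_dist_le (phi psi : R -> R) K : tame phi -> tame psi ->
  (forall t, `|phi t - psi t| <= K) -> `|gauss_mean phi - gauss_mean psi| <= K.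
Proof.
move=> tphi tpsi H; rewrite -mulN1r -gauss_meanZ // -gauss_meanD //;
  last exact: tameM (tame_cst _) _.
rewrite -[leRHS]gauss_mean_cst; apply: gauss_mean_norm_le; last by move=> t;
  rewrite mulN1r.
  by apply: tameD => //; exact: tameM (tame_cst _) _.
exact: tame_cst.
Qed.

Lemma smear_lip L F n c : lip_le L F -> lip_le L (smear n c F).
Proof.
move=> LF; have [L0 HF] := LF; split=> // x y.
apply: gauss_mean_dist_le; [exact: tame_line LF|exact: tame_line LF|move=> t].
by apply: le_trans (HF _ _) _; rewrite opprD addrACA subrr addr0.
Qed.

(** The mean of [F] at [sum_(n < N) (a n + sg n * xi_n) *: e n], as an
    iterated one-dimensional mean; the coefficient sequence is an argument of
    the operator so that it can be varied. *)
Fixpoint smoothing N a F : R := if N is N'.+1 then smoothing N' a (smear N'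
    (a N') F) else F 0.

(** Two points are compared by using the same Gaussian variables for both. The
    functions are allowed to differ so that the induction goes through; the
    Lipschitz estimate and the stability under uniform perturbations of [F]
    are special cases. *)
Lemma smoothing_coupling N a a' L L' F F' K : lip_le L F -> lip_le L' F' ->
  (forall y, `|F (y + \sum_(n < N) (a n - a' n) *: e n) - F' y| <= K) ->
  `|smoothing N a F - smoothing N a' F'| <= K.
Proof.
elim: N F F' => [|N IHN] F F' LF LF' H /=.
  by have := H 0; rewrite big_ord0 addr0.
apply: IHN; [exact: smear_lip|exact: smear_lip|move=> y].
apply: gauss_mean_dist_le; [exact: tame_line LF|exact: tame_line LF'|move=> t].
have := H (y + (a' N + sg N * t) *: e N); congr (`|F _ - _| <= _).
rewrite big_ord_recr /= -!addrA; congr (_ + _).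
rewrite addrCA; congr (_ + _); rewrite -scalerDl; congr (_ *: _).
by ring.
Qed.

Lemma smoothing_dist N a L L' F F' K : lip_le L F -> lip_le L' F' ->
  (forall y, `|F y - F' y| <= K) -> `|smoothing N a F - smoothing N a F'| <= K.
Proof.
move=> LF LF' H; apply: (smoothing_coupling LF LF') => y.
by rewrite big1 ?addr0 // => n _; rewrite subrr scale0r.
Qed.

Lemma smoothing_lipschitz N a a' L F : lip_le L F ->
  `|smoothing N a F - smoothing N a' F| <=
    L * `|\sum_(n < N) (a n - a' n) *: e n|.
Proof.
move=> LF; have [L0 HF] := LF; apply: (smoothing_coupling LF LF) => y.
by apply: le_trans (HF _ _) _; rewrite addrAC subrr add0r.
Qed.

Lemma smoothingD N a L L' F G : lip_le L F -> lip_le L' G ->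
  smoothing N a (fun y => F y + G y) = smoothing N a F + smoothing N a G.
Proof.
elim: N F G => [|N IHN] F G LF LG //=.
rewrite -IHN; [|exact: smear_lip|exact: smear_lip].
congr smoothing; apply/funext => y; rewrite /smear -gauss_meanD //;
  exact: tame_line LF || exact: tame_line LG.
Qed.

Lemma smoothingZ N a L F c : lip_le L F ->
    smoothing N a (fun y => c * F y) = c * smoothing N a F.
Proof.
elim: N F => [|N IHN] F LF //=.
rewrite -IHN; last exact: smear_lip.
by congr smoothing; apply/funext =>
  y; rewrite /smear -gauss_meanZ //; exact: tame_line LF.
Qed.

Lemma smoothing0 N a : smoothing N a (fun=> 0) = 0.
Proof.
have E : (fun _ : X => 0 * 0) = (fun=> 0) :> (X -> R).
  by apply/funext => y; rewrite mul0r.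
by rewrite -[in LHS]E (smoothingZ N a 0 lip_le0) mul0r.
Qed.

Lemma smoothing_sum N a L (F_ : nat -> X ->
    R) n : (forall i, lip_le L (F_ i)) ->
  smoothing N a (fun y => \sum_(i < n) F_ i y) =
    \sum_(i < n) smoothing N a (F_ i).
Proof.
move=> LF.
have Ls m : lip_le (m%:R * L) (fun y => \sum_(i < m) F_ i y).
  elim: m => [|m IHm].
    rewrite mul0r; have := lip_le0; congr lip_le; apply/funext => y.
    by rewrite big_ord0.
  rewrite -natr1 mulrDl mul1r; have := lip_leD IHm (LF m); congr lip_le.
  by apply/funext => y; rewrite big_ord_recr.
elim: n => [|n IHn].
  by rewrite big_ord0 -[RHS](smoothing0 N a); congr smoothing; apply/funext =>
    y; rewrite big_ord0.
rewrite big_ord_recr /= -IHn -(smoothingD N a (Ls n) (LF n)).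
by congr smoothing; apply/funext => y; rewrite big_ord_recr.
Qed.

(** One constant that dominates all the Gaussian moments needed below. *)
Definition exp_moment : R := gauss_mean (fun t => expR (2 * `|t|)).

Lemma exp_moment_ge1 : 1 <= exp_moment.
Proof.
rewrite -[leLHS]gauss_mean_cst; apply: gauss_mean_le;
  [exact: tame_cst|exact: tame_exp_abs|].
by move=> t; rewrite -expR0 ler_expR mulr_ge0.
Qed.

Lemma gauss_mean_le_exp_moment (phi : R -> R) B : tame phi ->
  (forall t, `|phi t| <= B * expR (2 * `|t|)) ->
    `|gauss_mean phi| <= B * exp_moment.
Proof.
move=> tphi H; rewrite -gauss_meanZ; last exact: tame_exp_abs.
by apply: gauss_mean_norm_le => //; apply: tameM;
  [exact: tame_cst|exact: tame_exp_abs].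
Qed.

Lemma abs_le_exp (t : R) : `|t| <= expR `|t|.
Proof. by apply: le_trans (expR_ge1Dx _); rewrite lerDr. Qed.

Lemma exp_le_exp2 (t : R) : expR `|t| <= expR (2 * `|t|).
Proof. by rewrite ler_expR ler_peMl //; lra. Qed.

Lemma smear_dist L F n c y : lip_le L F ->
  `|smear n c F y - F (y + c *: e n)| <= L * sg n * exp_moment.
Proof.
move=> LF; have [L0 HF] := LF.
rewrite -[F (y + c *: e n)]gauss_mean_cst -mulN1r -gauss_meanZ;
  last exact: tame_cst.
have tN : tame (fun _ : R => -1 * F (y + c *: e n)) by exact: tame_cst.
rewrite -gauss_meanD //; last exact: tame_line LF.
apply: gauss_mean_le_exp_moment; first by apply: tameD =>
  //; exact: tame_line LF.
move=> t; rewrite mulN1r; apply: le_trans (HF _ _) _.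
rewrite opprD addrACA subrr add0r -scalerBl addrAC subrr add0r normrZ normrM.
rewrite (gtr0_norm (sg_gt0 n)) -!mulrA ler_wpM2l // ler_wpM2l ?(ltW
  (sg_gt0 n)) //.
apply: (@le_trans _ _ `|t|); first by rewrite ler_piMr.
exact: le_trans (abs_le_exp _) (exp_le_exp2 _).
Qed.

Lemma smoothing_center N a L F : lip_le L F ->
  `|smoothing N a F - F (\sum_(n < N) a n *: e n)| <=
    L * exp_moment * \sum_(n < N) sg n.
Proof.
elim: N F => [|N IHN] F LF; first by rewrite !big_ord0 /= subrr normr0 mulr0.
rewrite !big_ord_recr /= mulrDr [leRHS]addrC.
have LS := lip_le_shift (a N *: e N) LF.
have -> : smoothing N a (smear N (a N) F) - F (\sum_(n < N) a n *: e n +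
  a N *: e N) =
  (smoothing N a (smear N (a N) F) - smoothing N a (fun y =>
    F (y + a N *: e N))) +
  (smoothing N a (fun y => F (y + a N *: e N)) - F (\sum_(n < N) a n *: e n +
    a N *: e N)).
  by rewrite addrA subrK.
apply: le_trans (ler_normD _ _) _; apply: lerD; last exact: IHN LS.
rewrite mulrAC; apply: (smoothing_dist _ _ (smear_lip _ _ LF) LS) => y.
exact: smear_dist.
Qed.

Lemma smoothing_increment_le N a L f : lip_le L f ->
  `|smoothing N.+1 a f - smoothing N a f| <= L * (`|a N| + sg N * exp_moment).
Proof.
move=> Lf; have [L0 Hf] := Lf.
apply: (smoothing_dist _ _ (smear_lip _ _ Lf) Lf) => y.
have -> : smear N (a N) f y - f y = (smear N (a N) f y - f (y + a N *: e N)) +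
   (f (y + a N *: e N) - f y) by rewrite addrA subrK.
apply: le_trans (ler_normD _ _) _; rewrite mulrDr [leRHS]addrC lerD //.
  by rewrite mulrA; exact: smear_dist.
apply: le_trans (Hf _ _) _; rewrite addrAC subrr add0r ler_wpM2l // normrZ.
by rewrite ler_piMr.
Qed.

End Smoothing.

(** * The smoothed function is analytic in the coefficients *)

Section SmoothingAnalytic.
Context {R : realType} {X : normedModType R} (e : nat -> X) (sg : nat -> R).
Context (e_le1 : forall n, `|e n| <= 1) (sg_gt0 : forall n, 0 < sg n).
Implicit Types (F G : X -> R) (x y h : X) (L : R).

Lemma analytic_leX r M (u : X -> R) n : 0 < r -> analytic_le r M u ->
  analytic_le r (M ^+ n.+1) (fun h => u h ^+ n.+1).
Proof.
move=> r0 Au; elim: n => [|n IHn].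
  by rewrite expr1; apply: analytic_le_ext Au => // h _; rewrite expr1.
by rewrite exprS; apply: analytic_le_ext (analytic_leM r0 Au IHn).
Qed.

Lemma geo_sum_le (x : R) n : 0 <= x -> x <= 2^-1 ->
    \sum_(i < n) x ^+ i.+1 <= 2 * x.
Proof.
move=> x0 x2.
have -> : \sum_(i < n) x ^+ i.+1 = x * \sum_(i < n) x ^+ i.
  by rewrite mulr_sumr; apply: eq_bigr => i _; rewrite exprS.
rewrite mulrC ler_wpM2r //.
have h : (1 - x) * \sum_(i < n) x ^+ i = 1 - x ^+ n.
  elim: n => [|n IHn]; first by rewrite big_ord0 mulr0 subrr.
  by rewrite big_ord_recr /= mulrDr IHn exprS; ring.
have : 0 <= x ^+ n by rewrite exprn_ge0.
have : 0 <= \sum_(i < n) x ^+ i by apply: sumr_ge0 => i _; rewrite exprn_ge0.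
by nra.
Qed.

Lemma analytic_le_gauss_factor r d (b : X -> R) : 0 < r -> d <= 2^-1 ->
    analytic_le r d b ->
  analytic_le r d (fun h => expR (- b h ^+ 2 / 2) - 1).
Proof.
move=> r0 d2 Ab; have d0 := analytic_le_ge0 Ab.
pose u h := - 2^-1 * b h ^+ 2.
have Au : analytic_le r (d ^+ 2 / 2) u.
  have := analytic_leZ (- 2^-1) (analytic_leX 1 r0 Ab);
    rewrite normrN ger0_norm // mulrC.
  exact.
apply: (@analytic_le_series _ _ _ _ (fun k => (d ^+ 2 / 2) ^+ k.+1)
  (fun k h => u h ^+ k.+1 / k.+1`!%:R)) => //.
- move=> k; have := analytic_leZ (k.+1`!%:R)^-1 (analytic_leX k r0 Au) => H.
  apply: analytic_le_weaken (analytic_le_ext r0 _ H) =>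
    // [|h _]; last by rewrite mulrC.
  rewrite ler_piMl ?exprn_ge0 ?divr_ge0 ?sqr_ge0 // normfV ger0_norm //.
  by rewrite invf_le1 ?ltr0n ?fact_gt0 // ler1n fact_gt0.
- move=> n; have dd : d ^+ 2 <= d * 2^-1 by rewrite expr2 ler_wpM2l.
  have dd0 : 0 <= d ^+ 2 by rewrite sqr_ge0.
  by apply: le_trans (geo_sum_le _ _ _) _; lra.
move=> h hr.
have E : - b h ^+ 2 / 2 = u h by rewrite /u; ring.
rewrite E.
have c1 : series (exp_coeff (u h)) n @[n --> \oo] --> expR (u h).
  exact: is_cvg_series_exp_coeff.
have c2 : series (exp_coeff (u h)) n.+1 - 1 @[n --> \oo] --> expR (u h) - 1.
  by apply: cvgB; [rewrite cvg_shiftS|exact: cvg_cst].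
apply: cvg_trans c2; apply: near_eq_cvg; apply: nearW => n.
rewrite /series /= big_mkord big_ord_recl /= /exp_coeff /= expr0 fact0 divr1.
by rewrite addrAC subrr add0r.
Qed.

Section Step.
Context (N : nat) (a : X -> nat -> R) (r P : R) (r0 : 0 < r) (P1 : 1 <= P).
Context (HN : forall F L B, lip_le L F -> (forall y, `|F y| <= B) ->
  analytic_le r (8 * B * P) (fun h => smoothing e sg N (a h) F)).

(** By [gauss_mean_shift] and [gauss_mean_exp_series] the function of [y] is
    [exp (-b^2/2)] times the sum of [b^i * G_i], where the functions [G_i]
    depend on [y] only and are uniformly bounded. The series converges
    uniformly in [y], hence commutes with [smoothing]. The term [i = 0] gets
    its own bound [B0] and the factor [exp (-b^2/2)] is written as [1] plus a
    small function: a product with the constant [1] would cost the norm [8] of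
    that constant at each step. *)
Lemma analytic_le_smoothing_step (Phi : R -> X -> R) (b : X -> R) L B B0 d :
  (forall t, lip_le L (Phi t)) -> (forall y, tame (Phi^~ y)) ->
  (forall t y, `|Phi t y| <= B * expR `|t|) ->
  (forall y, `|gauss_mean (Phi^~ y)| <= B0) -> d <= 2^-1 -> analytic_le r d b ->
  analytic_le r (8 * P * (B0 + 2 * d * B * exp_moment) * (1 + d))
    (fun h => smoothing e sg N (a h) (fun y => gauss_mean (fun t =>
      Phi (b h + t) y))).
Proof.
move=> LPhi tPhi BPhi B0Phi d2 Ab; have d0 := analytic_le_ge0 Ab.
have L0 : 0 <= L by case: (LPhi 0).
have B_ge0 : 0 <= B.
  by have := le_trans (normr_ge0 _) (BPhi 0 0); rewrite pmulr_lge0 // expR_gt0.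
pose G i y := gauss_mean (fun t => Phi t y * (t ^+ i / i`!%:R)).
have tG i y : tame (fun t => Phi t y * (t ^+ i / i`!%:R)).
  by apply: tameM => //; exact: tame_pow.
have tle i (t : R) : `|t ^+ i / i`!%:R| <= expR `|t|.
  rewrite normrM normrX normfV (ger0_norm (ler0n _ _)).
  exact: pow_fact_le.
have e2 (t : R) : expR (2 * `|t|) = expR `|t| * expR `|t|.
  by rewrite -expRD; congr expR; ring.
have LG i : lip_le (L * exp_moment) (G i).
  split=> [|x y]; first by rewrite mulr_ge0 // (le_trans _ exp_moment_ge1).
  rewrite -mulN1r -gauss_meanZ // -gauss_meanD //;
    last exact: tameM (tame_cst _) _.
  rewrite mulrAC; apply: gauss_mean_le_exp_moment.
    by apply: tameD => //; exact: tameM (tame_cst _) _.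
  move=> t; rewrite mulN1r -mulrBl normrM; case: (LPhi t) => _ HL.
  apply: ler_pM => //; apply: le_trans (tle _ _) _; exact: exp_le_exp2.
have BG i y : `|G i y| <= B * exp_moment.
  apply: gauss_mean_le_exp_moment => // t; rewrite normrM e2 mulrA.
  by apply: ler_pM.
have BG0 y : `|G 0%N y| <= B0.
  rewrite /G (_ : (fun t => _) = Phi^~ y); first exact: B0Phi.
  by apply/funext => t; rewrite expr0 fact0 divr1 mulr1.
pose H b' y := gauss_mean (fun t => Phi t y * expR (b' * t)).
pose D := gauss_mean (fun t => B * expR (3 * `|t|)).
have HG b' n y : `|b'| <= 2^-1 ->
    `|H b' y - \sum_(i < n) b' ^+ i * G i y| <= D * 2^-1 ^+ n.
  by move=> hb; apply: gauss_mean_exp_series.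
have LH b' : `|b'| <= 2^-1 -> lip_le (L * exp_moment) (H b').
  move=> hb; split=> [|x y]; first by rewrite mulr_ge0 //
    (le_trans _ exp_moment_ge1).
  have tH z : tame (fun t => Phi t z * expR (b' * t)).
    by apply: tameM => //; exact: tame_exp.
  rewrite -mulN1r -gauss_meanZ // -gauss_meanD //;
    last exact: tameM (tame_cst _) _.
  rewrite mulrAC; apply: gauss_mean_le_exp_moment.
    by apply: tameD => //; exact: tameM (tame_cst _) _.
  move=> t; rewrite mulN1r -mulrBl normrM; case: (LPhi t) => _ HL.
  apply: ler_pM => //; rewrite ger0_norm ?expR_ge0 // ler_expR.
  apply: le_trans (ler_norm _) _; rewrite normrM ler_wpM2r //; lra.
have bd h : `|h| <= r / 2 -> `|b h| <= 2^-1.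
  by move=> hr; apply: le_trans d2; exact: analytic_le_norm Ab hr.
(* The bound [BG] for [G 0] would lose a constant factor at each step. *)
pose B_ i := if i is 0%N then B0 else B * exp_moment.
have AG i : analytic_le r (8 * B_ i * P) (fun h =>
  smoothing e sg N (a h) (G i)).
  by case: i => [|i]; [exact: HN (LG 0%N) BG0|exact: HN (LG i.+1) (BG i.+1)].
pose m_ i := d ^+ i * (8 * B_ i * P).
have B00 : 0 <= B0 by apply: le_trans (B0Phi 0).
have cE0 : 0 <= exp_moment :> R by apply: le_trans exp_moment_ge1.
have AH : analytic_le r (8 * P * (B0 + 2 * d * B * exp_moment)) (fun h =>
  smoothing e sg N (a h) (H (b h))).
  apply: (@analytic_le_series _ _ _ _ m_ (fun i h =>
    b h ^+ i * smoothing e sg N (a h) (G i))) => //.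
  - case=> [|i]; last by apply: analytic_leM => //; exact: analytic_leX.
    rewrite /m_ expr0 mul1r; apply: analytic_le_ext (AG 0%N) => // h _.
    by rewrite expr0 mul1r.
  - case=> [|n].
      by rewrite big_ord0 !mulr_ge0 ?addr_ge0 ?mulr_ge0 // (le_trans _ P1).
    rewrite big_ord_recl /m_ /= expr0 mul1r mulrDr.
    have -> : 8 * B0 * P = 8 * P * B0 by ring.
    rewrite lerD2l -mulr_suml.
    have -> : 8 * P * (2 * d * B * exp_moment) =
      (2 * d) * (8 * (B * exp_moment) * P) by ring.
    rewrite ler_wpM2r ?geo_sum_le //.
    by rewrite !mulr_ge0 // (le_trans _ P1).
  move=> h hr; have hb := bd h hr.
  have S n : `|smoothing e sg N (a h)
    (H (b h)) - \sum_(i < n) b h ^+ i * smoothing e sg N (a h) (G i)|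
      <= D * 2^-1 ^+ n.
    have Lb i : lip_le (L * exp_moment) (fun y => b h ^+ i * G i y).
      have [l0 hl] := lip_leZ (b h ^+ i) (LG i).
      split=> [|x y]; first by case: (LG i).
      apply: le_trans (hl x y) _; rewrite ler_wpM2r // ler_piMl //.
        by case: (LG i).
      rewrite normrX exprn_ile1 //; lra.
    have -> : \sum_(i < n) b h ^+ i * smoothing e sg N (a h) (G i) =
        smoothing e sg N (a h) (fun y => \sum_(i < n) b h ^+ i * G i y).
      rewrite (smoothing_sum e_le1 sg_gt0 N (a h) n Lb); apply: eq_bigr => i _.
      by rewrite (smoothingZ e_le1 sg_gt0 N (a h) _ (LG i)).
    have LS : lip_le (n%:R * (L * exp_moment)) (fun y =>
      \sum_(i < n) b h ^+ i * G i y).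
      elim: n => [|n IHn].
        rewrite mul0r; have := @lip_le0 R X; congr lip_le; apply/funext => y.
        by rewrite big_ord0.
      rewrite -natr1 mulrDl mul1r; have := lip_leD IHn (Lb n); congr lip_le.
      by apply/funext => y; rewrite big_ord_recr.
    by apply: (smoothing_dist e_le1 sg_gt0 _ _ (LH _ hb) LS) => y; exact: HG.
  have c0 : D * (2^-1 : R) ^+ n @[n --> \oo] --> (0 : R).
    rewrite -[X in _ --> X](mulr0 D); apply: cvgM; first exact: cvg_cst.
    exact: cvg_half.
  apply/cvgrPdist_le => eps eps0; have /cvgrPdist_le/(_ _ eps0) := c0.
  apply: filterS => n; rewrite sub0r normrN => He.
  apply: le_trans (S n) _; exact: le_trans (ler_norm _) He.
have Af := analytic_le_gauss_factor r0 d2 Ab.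
have := analytic_leD AH (analytic_leM r0 AH Af).
rewrite -[X in X + _]mulr1 -mulrDr; apply: analytic_le_ext => // h hr.
have hb := bd h hr.
rewrite -[X in X + _]mulr1 -mulrDr addrC subrK mulrC.
rewrite -(smoothingZ e_le1 sg_gt0 N (a h) _ (LH _ hb)); congr smoothing.
apply/funext => y; rewrite /H -(gauss_mean_shift (b h) (tPhi y)).
by [].
Qed.

End Step.

Section LocalBounds.
Context (c : nat -> R) (a : X -> nat -> R) (r : R) (r0 : 0 < r).
Context (Aa : forall n, analytic_le r ((20 * exp_moment)^-1 * 2^-1 ^+ n)
   (fun h => (a h n - c n) / sg n)).

Let d n : R := (20 * exp_moment)^-1 * 2^-1 ^+ n.

Let exp_moment1 : 1 <= exp_moment :> R. Proof. exact: exp_moment_ge1. Qed.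

Let d_ge0 n : 0 <= d n.
Proof. by rewrite mulr_ge0 ?exprn_ge0 // invr_ge0; have :=
  exp_moment1; lra. Qed.

Let exp_moment_d n : 20 * (exp_moment * d n) = 2^-1 ^+ n.
Proof. by rewrite /d; field; rewrite gt_eqF //; have := exp_moment1; lra. Qed.

Let d_le n : d n <= 20^-1 * 2^-1 ^+ n.
Proof.
have h : d n <= exp_moment * d n by rewrite ler_peMl ?d_ge0.
by have := exp_moment_d n; lra.
Qed.

Let half_le1 n : 2^-1 ^+ n <= 1 :> R.
Proof. by rewrite exprn_ile1 //; lra. Qed.

Let aE h n t : a h n + sg n * t = c n + sg n * ((a h n - c n) / sg n + t).
Proof. by field; rewrite gt_eqF. Qed.

(** Each step multiplies the norm by at most [1 + 2^-n / 4], and the bound [2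
    - 2^-N] absorbs these factors. *)
Lemma analytic_le_smoothing N F L B : lip_le L F -> (forall y, `|F y| <= B) ->
  analytic_le r (8 * B * (2 - 2^-1 ^+ N)) (fun h => smoothing e sg N (a h) F).
Proof.
elim: N F L B => [|N IHN] F L B LF BF.
  have B0 : 0 <= B by apply: le_trans (BF 0).
  rewrite expr0; apply: analytic_le_weaken (analytic_le_cst (F 0) r0) => //.
  by have := BF 0; lra.
have B0 : 0 <= B by apply: le_trans (BF 0).
have P1 : 1 <= 2 - 2^-1 ^+ N :> R by have := half_le1 N; lra.
have d2 : d N <= 2^-1 by have := d_le N; have := half_le1 N; lra.
pose Phi t y := F (y + (c N + sg N * t) *: e N).
have H := @analytic_le_smoothing_step N a r _ r0 P1 IHN Phi (fun h =>
  (a h N - c N) / sg N)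
  L B B (d N) _ _ _ _ d2 (Aa N).
apply: analytic_le_weaken (analytic_le_ext r0 _ (H _ _ _ _)) => //.
- have h1 := exp_moment_d N; have h2 := d_le N; have h3 := d_ge0 N.
  have p0 : 0 <= 2^-1 ^+ N :> R by rewrite exprn_ge0.
  have -> : B + 2 * d N * B * exp_moment =
    B * (1 + 2 * (exp_moment * d N)) by ring.
  have -> : 8 * (2 - 2^-1 ^+ N) * (B * (1 + 2 * (exp_moment * d N))) * (1 +
    d N) =
    8 * B * ((2 - 2^-1 ^+ N) * ((1 + 2 * (exp_moment * d N)) * (1 +
      d N))) by ring.
  apply: ler_wpM2l; first by rewrite mulr_ge0.
  have -> : exp_moment * d N = 20^-1 * 2^-1 ^+ N by rewrite -h1; field.
  rewrite exprS; have q1 := half_le1 N.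
  move: (2^-1 ^+ N) (d N) p0 h2 h3 q1 => p dd p0 h2 h3 q1.
  apply: (@le_trans _ _ ((2 - p) * ((1 + 2 * (20^-1 * p)) * (1 + 20^-1 * p)))).
    rewrite ler_wpM2l //; first by lra.
    by rewrite ler_wpM2l //; lra.
  by nra.
- move=> h _ /=; congr smoothing; apply/funext => y; rewrite /smear /Phi.
  by congr gauss_mean; apply/funext => t; rewrite aE.
- by move=> t; exact: lip_le_shift LF.
- by move=> y; exact: tame_line LF.
- move=> t y; apply: le_trans (BF _) _; rewrite ler_peMr //.
  by rewrite -[leLHS]expR0 ler_expR.
- move=> y; rewrite -[leRHS]gauss_mean_cst; apply: gauss_mean_norm_le => //.
  + exact: tame_line LF.
  + exact: tame_cst.
  + by move=> t; exact: BF.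
Qed.

(** The increment is the smoothing of the function [smear N (a h N) f - f].
    This function is bounded by a multiple of [|c N| + sg N] although [f] need
    not be bounded. *)
Lemma analytic_le_smoothing_increment N L f : lip_le L f ->
  analytic_le r (64 * exp_moment * L * (`|c N| + sg N))
    (fun h => smoothing e sg N.+1 (a h) f - smoothing e sg N (a h) f).
Proof.
move=> Lf; have [L0 Hf] := Lf.
have P1 : 1 <= 2 - 2^-1 ^+ N :> R by have := half_le1 N; lra.
have d2 : d N <= 2^-1 by have := d_le N; have := half_le1 N; lra.
pose Phi t y := f (y + (c N + sg N * t) *: e N) - f y.
pose B := L * (`|c N| + sg N).
have B0 : 0 <= B by rewrite mulr_ge0 // addr_ge0 // ltW.
have tPhi y : tame (Phi^~ y).
  by apply: tameD; [exact: tame_line Lf|exact: tame_cst].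
have BPhi t y : `|Phi t y| <= B * expR `|t|.
  apply: le_trans (Hf _ _) _; rewrite addrAC subrr add0r -mulrA ler_wpM2l //.
  rewrite normrZ; apply: (@le_trans _ _ `|c N +
    sg N * t|); first by rewrite ler_piMr.
  apply: le_trans (ler_normD _ _) _; rewrite mulrDl lerD //.
    by rewrite ler_peMr // -[leLHS]expR0 ler_expR.
  by rewrite normrM gtr0_norm // ler_wpM2l ?abs_le_exp // ltW.
have H := @analytic_le_smoothing_step N a r _ r0 P1
  (@analytic_le_smoothing N) Phi (fun h => (a h N - c N) / sg N)
  (L + L) B (B * exp_moment) (d N) _ tPhi BPhi _ d2 (Aa N).
apply: analytic_le_weaken (analytic_le_ext r0 _ (H _ _)) => //.
- have -> : 64 * exp_moment * L * (`|c N| + sg N) =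
  64 * (B * exp_moment) by rewrite /B; ring.
  have BC : 0 <= B * exp_moment by rewrite mulr_ge0 //; have :=
    exp_moment1; lra.
  have -> : 8 * (2 - 2^-1 ^+ N) * (B * exp_moment +
    2 * d N * B * exp_moment) * (1 + d N) =
    (8 * ((2 - 2^-1 ^+ N) * ((1 + 2 * d N) * (1 +
      d N)))) * (B * exp_moment) by ring.
  apply: ler_wpM2r => //.
  have p0 : 0 <= 2^-1 ^+ N :> R by rewrite exprn_ge0.
  have h3 := d_ge0 N.
  have h4 : (1 + 2 * d N) * (1 + d N) <= 3 by nra.
  have h5 : 0 <= (1 + 2 * d N) * (1 + d N) by rewrite mulr_ge0 //; lra.
  by nra.
- move=> h _ /=.
  rewrite -[- smoothing e sg N (a h) f]mulN1r -(smoothingZ e_le1 sg_gt0 N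
    (a h) _ Lf).
  rewrite -(smoothingD e_le1 sg_gt0 N (a h) (smear_lip e_le1 sg_gt0 N _ Lf)
    (lip_leZ (-1) Lf)).
  congr smoothing; apply/funext => y; rewrite /smear /Phi.
  have tl := tame_line e_le1 sg_gt0 y (a h N) N Lf.
  rewrite mulN1r -[X in _ = _ + X]gauss_mean_cst -gauss_meanD //;
    last exact: tame_cst.
  by congr gauss_mean; apply/funext => t; rewrite aE.
- move=> t; have := lip_leD (lip_le_shift ((c N +
  sg N * t) *: e N) Lf) (lip_leZ (-1) Lf).
  rewrite normrN1 mul1r; congr lip_le; apply/funext => y.
  by rewrite mulN1r.
- move=> y; apply: gauss_mean_le_exp_moment =>
  // t; apply: le_trans (BPhi _ _) _.
  by rewrite ler_wpM2l // exp_le_exp2.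
Qed.

End LocalBounds.

End SmoothingAnalytic.

(** * The approximation theorem *)

Lemma cvg_of_geometric_steps (R : realType) (u : nat -> R) (C : R) :
  (forall n, `|u n.+1 - u n| <= C * 2^-1 ^+ n) -> cvgn u.
Proof.
move=> H.
have uE : u = (fun n => u 0%N + series (fun k => u k.+1 - u k) n).
  apply/funext; elim=> [|n IHn].
    by rewrite /series /= big_geq // addr0.
  by rewrite seriesSr addrA -IHn subrKC.
rewrite uE; apply: is_cvgD; first exact: is_cvg_cst.
apply: normed_cvg.
apply: (@series_le_cvg _ _ (geometric C 2^-1)) => //.
- by move=> n; exact: normr_ge0.
- by move=> n /=; apply: le_trans (H n).
- by apply: is_cvg_geometric_series; rewrite ger0_norm //; lra.
Qed.

Section Approximation.
Context {R : realType} {X : normedModType R} (ip : X -> X -> R).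
Context (ip_inner : inner_product ip) (e : nat -> X)
  (one : orthonormal_system ip e)
  (total : forall x, `|tail ip e n x| @[n --> \oo] --> 0).
Implicit Types (x y h : X).

Lemma half_sum n : \sum_(k < n) 2^-1 ^+ k <= 2 :> R.
Proof.
suff -> : \sum_(k < n) 2^-1 ^+ k = 2 - 2 * 2^-1 ^+ n :> R.
  by rewrite gerBl mulr_ge0 // exprn_ge0.
elim: n => [|n IHn]; first by rewrite big_ord0 expr0; ring.
by rewrite big_ord_recr /= IHn exprS; lra.
Qed.

Lemma quarter_le_half n : 4^-1 ^+ n <= 2^-1 ^+ n :> R.
Proof. by rewrite lerXn2r ?nnegrE //; lra. Qed.

(** The parameter [m] is chosen for the Lipschitz constant; then [om], for the
    displacement, and [s], for the Gaussian averaging, each take half of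
    [eps]. *)
Lemma approximation (f : X -> R) L eps zeta : lip_le L f -> 0 < eps ->
    0 < zeta ->
  exists g : X -> R, [/\ lip_le (L * (1 + zeta)) g, real_analytic g &
    forall x, `|f x - g x| <= eps].
Proof.
move=> Lf eps0 zeta0; have [L0 Hf] := Lf.
have [m m0 Hlip] := truncation_lipschitz ip_inner one zeta0.
have C1 := @exp_moment_ge1 R.
have L1 : 0 < L + 1 by lra.
pose s := eps / (4 * exp_moment * (L + 1)).
have s0 : 0 < s by rewrite divr_gt0 // mulr_gt0 //; lra.
pose om := 4 * 2 ^+ m * (L + 1) / eps.
have om0 : 0 < om by rewrite divr_gt0 // !mulr_gt0 // exprn_gt0.
pose sg n : R := s * 2^-1 ^+ n.
have sg0 n : 0 < sg n by rewrite mulr_gt0 // exprn_gt0.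
have e1 := orthonormal_norm_le1 one.
pose a x n := trunc_coef ip e om m n x.
have h0 n : 0 <= 2^-1 ^+ n :> R by rewrite exprn_ge0.
have step x : exists2 K, 0 <= K & forall n,
    `|smoothing e sg n.+1 (a x) f - smoothing e sg n (a x) f| <= K * 2^-1 ^+ n.
  have [r [K [r0 K0 HK]]] := analytic_le_trunc_coef ip_inner one total x om0 m0.
  exists (L * (K + s * exp_moment)).
    by rewrite mulr_ge0 // addr_ge0 // mulr_ge0 //; lra.
  move=> n; apply: le_trans (smoothing_increment_le e1 sg0 n (a x) Lf) _.
  rewrite -[leRHS]mulrA ler_wpM2l // mulrDl lerD //.
    have [_ H] := HK n; apply: le_trans H _.
    by rewrite ler_wpM2l // quarter_le_half.
  by rewrite /sg mulrAC.
pose g x := limn (fun N => smoothing e sg N (a x) f).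
have cg x : smoothing e sg N (a x) f @[N --> \oo] --> g x.
  by have [K _ HK] := step x; exact: cvg_of_geometric_steps HK.
exists g; split.
- split=> [|x y]; first by rewrite mulr_ge0 // addr_ge0 // ltW.
  have cxy : `|smoothing e sg N (a x) f - smoothing e sg N
    (a y) f| @[N --> \oo] --> `|g x - g y|.
    by apply: cvg_norm; apply: cvgB; exact: cg.
  rewrite -(cvg_lim _ cxy) //; apply: limr_le; first exact: cvgP cxy.
  apply: nearW => N; apply: le_trans (smoothing_lipschitz e1 sg0 N (a x)
    (a y) Lf) _.
  by rewrite -[leRHS]mulrA ler_wpM2l // Hlip.
- apply: analytic_le_real_analytic => x.
  have [r [K [r0 K0 HK]]] := analytic_le_trunc_coef ip_inner one total x om0 m0.
  (* Shrinking the radius by [rho] turns the bounds [K * 4^-n / sg n] into the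
     small ones required of the normalised coefficients. *)
  pose rho := s / (20 * exp_moment * (K + 1) + s).
  have den0 : 0 < 20 * exp_moment * (K + 1) + s.
    by rewrite addr_gt0 // !mulr_gt0 //; lra.
  have rho0 : 0 < rho by rewrite divr_gt0.
  have rho1 : rho <= 1.
    by rewrite ler_pdivrMr // mul1r lerDr !mulr_ge0 //; lra.
  have lr0 : 0 < rho * r by rewrite mulr_gt0.
  pose c n := trunc_coef ip e om m n x.
  have Aa n : analytic_le (rho * r) ((20 * exp_moment)^-1 * 2^-1 ^+ n)
      (fun h => (a (x + h) n - c n) / sg n).
    have [An1 _] := HK n.
    have := analytic_le_shrink r0 (_ : 0 < rho <=
      1) _ (analytic_leZ (sg n)^-1 An1).
    rewrite rho0 rho1 addr0 subrr mulr0 => /(_ isT erefl) H.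
    apply: analytic_le_weaken (analytic_le_ext lr0 _ H) =>
      //; last by move=> h _; rewrite mulrC.
    rewrite gtr0_norm ?invr_gt0 //.
    have E4 : 4^-1 ^+ n = 2^-1 ^+ n * 2^-1 ^+ n :> R.
      by rewrite -exprMn -invfM -natrM.
    have -> : rho * ((sg n)^-1 * (K * 4^-1 ^+ n)) =
      K / (20 * exp_moment * (K + 1) + s) * 2^-1 ^+ n.
      rewrite E4 /rho /sg; field; rewrite !gt_eqF ?exprn_gt0 //.
    rewrite ler_wpM2r // ler_pdivrMr // mulrC ler_pdivlMr ?mulr_gt0 //; lra.
  exists (rho * r), (64 * exp_moment * L * ((K + s) * 2) +
    8 * `|f 0|); split=> //.
  pose D k h := smoothing e sg k.+1 (a (x + h)) f - smoothing e sg k (a (x +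
    h)) f.
  have AD k : analytic_le (rho * r) (64 * exp_moment * L * ((K +
    s) * 2^-1 ^+ k)) (D k).
    apply: analytic_le_weaken (analytic_le_smoothing_increment e1 sg0 lr0 Aa k
      Lf) => //.
    rewrite ler_wpM2l ?mulr_ge0 //; first by lra.
    rewrite mulrDl lerD //; have [_ H] := HK k; apply: le_trans H _.
    by rewrite ler_wpM2l // quarter_le_half.
  have AS : analytic_le (rho * r) (64 * exp_moment * L * ((K +
    s) * 2)) (fun h => g (x + h) - f 0).
    apply: (analytic_le_series lr0 AD) => [n|h _].
      rewrite -!mulr_sumr !ler_wpM2l ?half_sum ?mulr_ge0 ?addr_ge0 //; lra.
    have E n : \sum_(k < n) D k h = smoothing e sg n (a (x + h)) f - f 0.
      elim: n => [|n IHn]; first by rewrite big_ord0 subrr.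
      by rewrite big_ord_recr /= IHn /D addrC addrA subrK.
    have -> : (fun n => \sum_(k < n) D k h) =
        (fun n => smoothing e sg n (a (x + h)) f - f 0).
      by apply/funext => n; exact: E.
    by apply: cvgB; [exact: cg|exact: cvg_cst].
  apply: analytic_le_ext (analytic_leD AS (analytic_le_cst (f 0) lr0)) =>
    // h _.
  by rewrite subrK.
- move=> x.
  have c1 : `|f x - smoothing e sg N
    (a x) f| - L * `|tail ip e N x| @[N --> \oo] -->
      `|f x - g x| - L * 0.
    apply: cvgB.
      by apply: cvg_norm; apply: cvgB; [exact: cvg_cst|exact: cg].
    by apply: cvgM; [exact: cvg_cst|exact: total].
  rewrite mulr0 subr0 in c1.
  rewrite -(cvg_lim _ c1) //; apply: limr_le; first exact: cvgP c1.
  apply: nearW => N; rewrite lerBlDr.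
  have -> : f x - smoothing e sg N (a x) f =
    (f x - f (\sum_(n < N) a x n *: e n)) +
      (f (\sum_(n < N) a x n *: e n) - smoothing e sg N
        (a x) f) by rewrite addrA subrK.
  apply: le_trans (ler_normD _ _) _.
  have H1 := Hf x (\sum_(n < N) a x n *: e n).
  have H2 := truncation_displacement ip_inner one N x om0 m0.
  have H3 := smoothing_center e1 sg0 N (a x) Lf; rewrite distrC in H3.
  have H4 : \sum_(n < N) sg n <= s * 2.
    by rewrite /sg -mulr_sumr ler_wpM2l ?half_sum // ltW.
  have H5 : L * exp_moment * \sum_(n < N) sg n <= L * exp_moment * (s * 2).
    by rewrite ler_wpM2l // mulr_ge0 //; lra.
  have H6 := ler_wpM2l L0 H2.
  have E1 : L * exp_moment * (s * 2) <= eps / 2.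
    have -> : L * exp_moment * (s * 2) = (L / (L + 1)) * (eps / 2).
      by rewrite /s; field; rewrite !gt_eqF //; lra.
    by rewrite ler_piMl ?divr_ge0 ?(ltW eps0) // ler_pdivrMr // mul1r; lra.
  have E2 : L * (2 * 2 ^+ m / om) <= eps / 2.
    have p2 : 0 < 2 ^+ m :> R by rewrite exprn_gt0.
    have -> : L * (2 * 2 ^+ m / om) = (L / (L + 1)) * (eps / 2).
      by rewrite /om; field; rewrite !gt_eqF //; lra.
    by rewrite ler_piMl ?divr_ge0 ?(ltW eps0) // ler_pdivrMr // mul1r; lra.
  rewrite mulrDr in H6.
  apply: le_trans (lerD (le_trans H1 H6) (le_trans H3 H5)) _.
  by lra.
Qed.

End Approximation.

Theorem theorem4 (R : realType) (X : completeNormedModType R)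
    (dot : {dot X for idfun})
    (norm_dot : forall x : X, `|x| = Num.sqrt (dot x x))
    (X_separable : separable_space X)
    (f : X -> R) (f_lipschitz : lipschitz f) (eps : R) (eps_gt0 : 0 < eps) :
  exists g : X -> R,
    [/\ lipschitz g,
        real_analytic g,
        forall x : X, `|f x - g x| <= eps &
        Lip g <= Lip f + eps].
Proof.
have ip_inner := dot_inner_product norm_dot.
have [e one total] := exists_total_orthonormal ip_inner X_separable.
pose S := [set k : R | 0 <= k /\ k.-lipschitz f].
(* The infimum defining [Lip f] need not be attained a priori: take a Lipschitz
   constant [L] of [f] below [Lip f + eps / 2]. *)
have S_inf : has_inf S.
  split; last by exists 0 => k [].
  have [k0 [k0r H]] := f_lipschitz.
  exists (Num.max (k0 + 1) 0); split; first by rewrite le_max lexx orbT.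
  by apply: H; rewrite lt_max ltrDl ltr01.
have e2 : 0 < eps / 2 by rewrite divr_gt0.
have [L [L0 fL] Lle] := inf_adherent e2 S_inf.
have Lf : lip_le L f by split=> // x y; exact: (fL (x, y) (conj I I)).
have z0 : 0 < eps / (2 * (L + 1)) by rewrite divr_gt0 // mulr_gt0 //; lra.
have [g [[M0 Hg] ag fg]] := approximation ip_inner one total Lf eps_gt0 z0.
set M := L * _ in M0 Hg.
have gM : M.-lipschitz g by move=> [x y] _; exact: Hg.
have ML : M <= Lip f + eps.
  apply: (@le_trans _ _ (L + eps / 2)).
    have -> : M = L + (L / (L + 1)) * (eps / 2).
      by rewrite /M; field; rewrite gt_eqF //; lra.
    rewrite lerD2l ler_piMl ?(ltW e2) // ler_pdivrMr; lra.
  by move: Lle; rewrite /Lip -/S; lra.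
exists g; split=> //.
  exists M; split; first exact: num_real.
  move=> k Mk [x y] _; apply: le_trans (Hg x y) _.
  by rewrite ler_wpM2r // ltW.
apply: le_trans ML; apply: ge_inf; last by split.
by exists 0 => k [].
Qed.
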